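(* Let $\mathcal H$ be a real Hilbert space, $T>0$, let $C\subset\mathcal H$ be a ball-compact set and $x_0\in C$. Let $F\colon[0,T]\times\mathcal H\rightrightarrows\mathcal H$ be a set-valued map with nonempty, closed and convex values such that: (1) for all $t\in[0,T]$, $F(t,\cdot)$ is upper semicontinuous from $\mathcal H$ into $\mathcal H_w$; (2) there is a Lipschitz continuous function $h\colon\mathcal H\to[0,+\infty[$ (with constant $L_h>0$) such that $d(0,F(t,x)):=\inf\{\|w\|:w\in F(t,x)\}\le h(x)$ for all $x\in\mathcal H$ and a.e. $t\in[0,T]$; (3) there are $\gamma>0$ and $f\colon[0,T]\times\mathcal H\to\mathcal H$ such that $f(t,x)\in\operatorname{proj}^{\gamma}_{F(t,x)}(0)$ for all $(t,x)$ and $f(\cdot,x)$ is measurable for all $x\in\mathcal H$. Let $(\varepsilon_n)$, $(\eta_n)$ be sequences of positive numbers with $\varepsilon_n/\mu_n^2\to0$ and $\eta_n/\mu_n\to 0$, where $\mu_n:=T/n$, and let $(x_n)$ be any sequence of functions generated by the inexact catching-up algorithm (with data $C,f,x_0,\varepsilon_n,\eta_n$) described in the context. Then $(x_n)$ converges uniformly on $[0,T]$, up to a subsequence, to a Lipschitz solution $x(\cdot)$ of $$\dot x(t)\in -N(C;x(t))+F(t,x(t))\ \text{ a.e. } t\in[0,T],\qquad x(0)=x_0\in C,$$ such that $$\|\dot x(t)\|\le 2\big(h(x(t))+\sqrt\gamma\big)\quad\text{a.e. }t\in[0,T].$$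
   Context: $\mathbb B$ is the closed unit ball of $\mathcal H$, and $\mathcal H_w$ is $\mathcal H$ with the weak topology. $d_S(x)=\inf_{z\in S}\|x-z\|$. A set $S$ is ball-compact if $S\cap r\mathbb B$ is compact for all $r>0$. Upper semicontinuity of a set-valued map $G\colon\mathcal H\rightrightarrows\mathcal H$ from $\mathcal H$ into $\mathcal H_w$: for every weakly closed $D\subset\mathcal H$, the set $\{x: G(x)\cap D\ne\emptyset\}$ is closed in $\mathcal H$. For $x\in S$, the Clarke tangent cone $T(S;x)$ is the set of $h\in\mathcal H$ such that for every sequence $(x_n)$ in $S$ converging to $x$ and every sequence of positive numbers $(t_n)$ converging to $0$ there is a sequence $(h_n)$ converging to $h$ with $x_n+t_nh_n\in S$ for all $n$. The Clarke normal cone is $N(S;x):=\{v:\langle v,h\rangle\le0\ \forall h\in T(S;x)\}$ for $x\in S$, and $N(S;x)=\emptyset$ if $x\notin S$. Approximate projections. For $\varepsilon>0$, $\operatorname{proj}_S^{\varepsilon}(x):=\{z\in S:\|x-z\|^2<d_S^2(x)+\varepsilon\}$. For $\varepsilon,\eta>0$, $\operatorname{proj}_S^{\varepsilon,\eta}(x):=\{z\in S_\eta:\|x-z\|^2<d_S^2(x)+\varepsilon\}$, where $S_\eta$ is any (arbitrarily chosen) closed set with $S\subset S_\eta\subset S+\eta\mathbb B$. Inexact catching-up algorithm (fixed set). For $n\in\mathbb N$, $n\ge1$, let $t_k^n:=kT/n$, $k=0,\dots,n$, and $\mu_n:=T/n$. Put $x_0^n=x_0$ and, for $k\in\{0,\dots,n-1\}$,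 choose $$x_{k+1}^n\in\operatorname{proj}_{C}^{\varepsilon_n,\eta_n}\Big(x_k^n+\int_{t_k^n}^{t_{k+1}^n}f(s,x_k^n)\,\mathrm ds\Big).$$ Define $x_n(0)=x_0$ and, for $t\in\,]t_k^n,t_{k+1}^n]$, $$x_n(t)=x_k^n+\frac{t-t_k^n}{\mu_n}\Big(x_{k+1}^n-x_k^n-\int_{t_k^n}^{t_{k+1}^n}f(s,x_k^n)\,\mathrm ds\Big)+\int_{t_k^n}^tf(s,x_k^n)\,\mathrm ds.$$ A solution of the differential inclusion is an absolutely continuous function $x\colon[0,T]\to\mathcal H$ with $x(0)=x_0$ satisfying the inclusion for a.e. $t\in[0,T]$. *)

(* Defs.v *)
From HB Require Import structures.
From mathcomp Require Export all_boot all_order all_algebra.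
From mathcomp Require Export all_classical all_reals all_analysis.
Export Order.TTheory GRing.Theory Num.Theory.
Export numFieldNormedType.Exports.

Set Implicit Arguments.
Unset Strict Implicit.
Unset Printing Implicit Defensive.

Local Open Scope classical_set_scope.
Local Open Scope ring_scope.

(* A real Hilbert space is a complete normed module H together with a dot
   product ip : {dot H for idfun} inducing its norm. *)
Definition induces_norm (R : realType) (H : normedModType R)
    (ip : {dot H for idfun}) : Prop :=
  forall u : H, ip u u = `|u| ^+ 2.

(* The weak topology: the coarsest one for which all elements of the
   topological dual are continuous. *)
Definition weak_space (R : realType) (H : normedModType R) : topologicalType :=
  @sup_topology H {phi : {linear H -> R^o} | continuous phi}
    (fun phi => Topological.on (initial_topology (sval phi : H -> R^o))).

Definition weakly_closed (R : realType) (H : normedModType R) (D : set H) :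
    Prop := @closed (weak_space H) D.

Definition usc_to_weak (R : realType) (H : normedModType R)
    (G : H -> set H) : Prop :=
  forall D : set H, weakly_closed D -> closed [set x | G x `&` D !=set0].

Section Sets.
Context {R : realType} {H : normedModType R}.
Implicit Types (S : set H) (x z : H).

Definition cball (r : R) : set H := [set z | `|z| <= r].

Definition ball_compact S : Prop := forall r, 0 < r -> compact (S `&` cball r).

(* [inf] is the infimum of the reals, so this is d_S(x) for nonempty S. *)
Definition dist_set S x : R := inf [set `|x - z| | z in S].

Definition approx_proj S (eps : R) x : set H :=
  [set z | S z /\ `|x - z| ^+ 2 < dist_set S x ^+ 2 + eps].

Definition enlargement S (eta : R) (Seta : set H) : Prop :=
  [/\ closed Seta, S `<=` Seta &
      Seta `<=` [set s + b | s in S & b in cball eta]].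

(* The dependence on eta is only through the chosen enlargement Seta of S;
   the distance is the one to S itself. *)
Definition approx_proj2 S Seta (eps : R) x : set H :=
  [set z | Seta z /\ `|x - z| ^+ 2 < dist_set S x ^+ 2 + eps].

Definition clarke_tangent S x : set H :=
  [set h | forall (xs : nat -> H) (ts : nat -> R),
    (forall n, S (xs n)) -> xs @ \oo --> x ->
    (forall n, 0 < ts n) -> ts @ \oo --> (0 : R) ->
    exists hs : nat -> H,
      hs @ \oo --> h /\ forall n, S (xs n + ts n *: hs n)].

Definition clarke_normal (ip : {dot H for idfun}) S x : set H :=
  [set v | S x /\ forall h, clarke_tangent S x h -> ip v h <= 0].

End Sets.

(* Simple functions R -> H, presented as finite sums of c_i * 1_{A_i}; the A_i
   need not be disjoint. *)
Record simple_fun (R : realType) (H : normedModType R) := SimpleFun {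
  sf_size : nat;
  sf_set : 'I_sf_size -> set (measurableTypeR R);
  sf_val : 'I_sf_size -> H;
  sf_measurable : forall i, measurable (sf_set i) }.

Section Bochner.
Context {R : realType} {H : normedModType R}.
Local Notation mu := (@lebesgue_measure R).
Implicit Types (g : R -> H) (s : nat -> simple_fun H).

Definition sf_eval (s : simple_fun H) (t : R) : H :=
  \sum_(i < sf_size s) \1_(sf_set i) t *: sf_val i.

Definition sf_int (a b : R) (s : simple_fun H) : H :=
  \sum_(i < sf_size s) fine (mu (`[a, b] `&` sf_set i)) *: sf_val i.

(* Strong (Bochner) measurability; the sets of simple functions are Borel, but
   since convergence is only required almost everywhere this is measurability
   with respect to the completed (Lebesgue) sigma-algebra. *)
Definition strongly_measurable (a b : R) g : Prop :=
  exists s, {ae mu, forall t, a <= t <= b ->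
                      (fun n => sf_eval (s n) t) @ \oo --> g t}.

Definition is_bochner_integral (a b : R) g (v : H) : Prop :=
  strongly_measurable a b g /\
  exists s,
    (fun n => (\int[mu]_(t in `[a, b]) (`|g t - sf_eval (s n) t|)%:E)%E)
      @ \oo --> 0%E /\
    (fun n => sf_int a b (s n)) @ \oo --> v.

Definition bochner_int (a b : R) g : H := xget 0 (is_bochner_integral a b g).

End Bochner.

Section Solutions.
Context {R : realType} {H : normedModType R}.
Local Notation mu := (@lebesgue_measure R).

Definition abs_continuous (a b : R) (x : R -> H) : Prop :=
  forall eps : R, 0 < eps -> exists2 delta : R, 0 < delta &
    forall (m : nat) (s t : 'I_m -> R),
      (forall i, [/\ a <= s i, s i <= t i & t i <= b]) ->
      (forall i j, i != j -> `]s i, t i[ `&` `]s j, t j[ = set0) ->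
      \sum_(i < m) (t i - s i) < delta ->
      \sum_(i < m) `|x (t i) - x (s i)| < eps.

(* x'(t) in - N(C; x(t)) + F(t, x(t)) for a.e. t in [0,T], x(0) = x0;
   functions on [0,T] are represented by functions on R, whose values outside
   [0,T] are irrelevant (a.e. t lies in ]0,T[). *)
Definition sweeping_solution (ip : {dot H for idfun}) (T : R) (C : set H)
    (F : R -> H -> set H) (x0 : H) (x : R -> H) : Prop :=
  [/\ abs_continuous 0 T x, x 0 = x0 &
    {ae mu, forall t, 0 <= t <= T ->
      derivable x t 1 /\
      [set - v + w | v in clarke_normal ip C (x t) & w in F t (x t)]
        (derive1 x t)}].

End Solutions.

Section CatchingUp.
Context {R : realType} {H : normedModType R}.

Definition grid (T : R) (n k : nat) : R := k%:R * T / n%:R.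

Definition catching_up (T : R) (C Ceta : set H) (f : R -> H -> H) (x0 : H)
    (eps : R) (n : nat) (y : nat -> H) (x : R -> H) : Prop :=
  let tk := grid T n in
  [/\ y 0%N = x0,
      (forall k, (k < n)%N ->
         approx_proj2 C Ceta eps
           (y k + bochner_int (tk k) (tk k.+1) (f^~ (y k))) (y k.+1)),
      x 0 = x0 &
      (forall k t, (k < n)%N -> tk k < t <= tk k.+1 ->
         x t = y k
           + ((t - tk k) / (T / n%:R)) *:
               (y k.+1 - y k - bochner_int (tk k) (tk k.+1) (f^~ (y k)))
           + bochner_int (tk k) t (f^~ (y k)))].

End CatchingUp.

(* Main.v *)
Require Import Defs.
From mathcomp Require Import ring lra measurable_realfun.

Set Implicit Arguments.
Unset Strict Implicit.
Unset Printing Implicit Defensive.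

Local Open Scope classical_set_scope.
Local Open Scope ring_scope.

(** The velocity of the scheme is [V - W]: on each cell, [V] is the selection
[f] frozen at the last node, and [W] is the correction made by the approximate
projection, divided by the step. Since [h] is Lipschitz, a discrete Gronwall
argument ([nodes_bounded]) bounds [V] and [W] uniformly. The iterates are then
equi-Lipschitz and closer and closer to the ball-compact set [C], so that a
subsequence converges uniformly to some [x] with values in [C]
([uniform_subsequence], an application of Tychonoff's theorem).

The velocities are passed to the limit without weak compactness. Among the
iterated midpoints of a tail of the sequence of triples (W, V, position),
choose one that almost minimizes the squared L2 norm of (W, V). By the
parallelogram identity these choices form an L2-Cauchy sequence
([almost_minimal_sequence]), and with a geometric rate they converge almost
everywhere to some (w, g) ([hull_cvg_ae]). The corresponding positions still
converge to [x], so that [x] is a primitive of [g - w], and Lebesgue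
differentiation, applied to countably many real functions [|g - w - d|], gives
[x' = g - w] almost everywhere ([velocity_limit], [ae_derivable]).

It remains to fix a time. A half-space that contains the velocities of all late
iterates contains the midpoints, hence the limit. As [F t] is upper
semicontinuous and a point outside of a closed convex set is separated from it
by a half-space, [g t] belongs to [F t (x t)] ([limit_field_in]). An element of
the Clarke tangent cone at [x t] provides points of [C] to which the almost
minimality of the approximate projections applies; testing it at a distance
small compared with the step, but large compared with the errors, gives
[limsup <W t, d> <= 0], so that [w t] is in the normal cone
([clarke_normal_limit]). The bound on the velocity passes to the limit in the
same way ([limit_velocity_le]).

Vector-valued integrals only occur paired with a fixed vector, as real
Lebesgue integrals: [bochner_representation] makes this reduction. *)

(** * Inner product and parallelogram identity *)

Section Hilbert.
Context {R : realType} {H : normedModType R} (ip : {dot H for idfun}).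
Hypothesis Hip : induces_norm ip.
Implicit Types u v w : H.

Lemma ip_sym u v : ip u v = ip v u.
Proof. by rewrite (@hermC R false idfun H ip u v) expr0 mul1r. Qed.

Lemma ipDl u v w : ip (u + v) w = ip u w + ip v w.
Proof. exact: linearDl. Qed.

Lemma ipNl u w : ip (- u) w = - ip u w.
Proof. exact: linearNl. Qed.

Lemma ipBl u v w : ip (u - v) w = ip u w - ip v w.
Proof. exact: linearBl. Qed.

Lemma ipZl a u w : ip (a *: u) w = a * ip u w.
Proof. exact: linearZl_LR. Qed.

Lemma ipDr u v w : ip w (u + v) = ip w u + ip w v.
Proof. by rewrite !(ip_sym w) ipDl. Qed.

Lemma ipBr u v w : ip w (u - v) = ip w u - ip w v.
Proof. by rewrite !(ip_sym w) ipBl. Qed.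

Lemma ipZr a u w : ip w (a *: u) = a * ip w u.
Proof. by rewrite !(ip_sym w) ipZl. Qed.

Lemma ip0l u : ip 0 u = 0.
Proof. by rewrite -(scale0r 0) ipZl mul0r. Qed.

Lemma ip_suml (I : Type) (r : seq I) (P : pred I) (E : I -> H) w :
  ip (\sum_(i <- r | P i) E i) w = \sum_(i <- r | P i) ip (E i) w.
Proof. by apply: (big_morph (ip^~ w)) => [u v|]; rewrite ?ipDl ?ip0l. Qed.

Lemma normB_sqr u v : `|u - v| ^+ 2 = `|u| ^+ 2 - 2 * ip u v + `|v| ^+ 2.
Proof. by rewrite -!Hip !(ipBl, ipBr) (ip_sym v u); ring. Qed.

Lemma normD_sqr u v : `|u + v| ^+ 2 = `|u| ^+ 2 + 2 * ip u v + `|v| ^+ 2.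
Proof. by rewrite -!Hip !(ipDl, ipDr) (ip_sym v u); ring. Qed.

Lemma parallelogram u v :
  `|u - v| ^+ 2 =
  2 * `|u| ^+ 2 + 2 * `|v| ^+ 2 - 4 * `|2^-1 *: (u + v)| ^+ 2.
Proof.
rewrite normrZ exprMn normB_sqr normD_sqr ger0_norm ?invr_ge0//.
by field.
Qed.

Lemma ip_polarization u v :
  ip u v = (`|u + v| ^+ 2 - `|u| ^+ 2 - `|v| ^+ 2) / 2.
Proof. by rewrite normD_sqr; field. Qed.

(** Expand the square of [(v, v) u - (u, v) v]. *)
Lemma ip_le_norm u v : `|ip u v| <= `|u| * `|v|.
Proof.
have [->|v0] := eqVneq v 0.
  by rewrite ip_sym ip0l !normr0 mulr0.
rewrite -(@ler_pXn2r _ 2)// ?nnegrE ?mulr_ge0// real_normK ?num_real//.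
have vp : 0 < `|v| ^+ 2 by rewrite exprn_gt0 ?normr_gt0.
have := sqr_ge0 `|(`|v| ^+ 2) *: u - (ip u v) *: v|.
rewrite normB_sqr !normrZ !exprMn ipZl ipZr real_normK ?num_real//.
rewrite real_normK ?num_real// => h.
rewrite -subr_ge0 -(pmulr_rge0 _ vp); apply: le_trans h _.
by lra.
Qed.

Lemma ip_le u v : ip u v <= `|u| * `|v|.
Proof. exact: le_trans (ler_norm _) (ip_le_norm _ _). Qed.

Lemma cvg_ipl (T : Type) (F : set_system T) {FF : Filter F} (f : T -> H) u w :
  f @ F --> u -> (fun t => ip (f t) w) @ F --> ip u w.
Proof.
move=> fu; apply/cvgrPdist_le => e e0.
have w1 : 0 < `|w| + 1 by rewrite ltr_wpDl.
have /cvgrPdist_le/(_ (e / (`|w| + 1)))/= := fu.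
move=> /(_ ltac:(by rewrite divr_gt0)); apply: filterS => t ht.
rewrite -ipBl; apply: le_trans (ip_le_norm _ _) _.
apply: (@le_trans _ _ (e / (`|w| + 1) * (`|w| + 1))).
  by apply: ler_pM => //; rewrite lerDl.
by rewrite divfK// gt_eqF.
Qed.

Lemma cvg_ip2 (T : Type) (F : set_system T) {FF : Filter F} (f g : T -> H) u v :
  f @ F --> u -> g @ F --> v -> (fun t => ip (f t) (g t)) @ F --> ip u v.
Proof.
move=> fu gv.
have -> : (fun t => ip (f t) (g t)) =
    (fun t => (`|f t + g t| ^+ 2 - `|f t| ^+ 2 - `|g t| ^+ 2) / 2).
  by apply/funext => t; rewrite ip_polarization.
rewrite ip_polarization; apply: cvgM; last exact: cvg_cst.
have sq (k : T -> H) (l : H) : k @ F --> l ->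
    (fun t => `|k t| ^+ 2) @ F --> `|l| ^+ 2.
  by move=> kl; under eq_fun do rewrite expr2; rewrite expr2;
    apply: cvgM; exact: cvg_norm.
apply: cvgB; last exact: sq.
by apply: cvgB; [apply: sq; exact: cvgD|exact: sq].
Qed.

End Hilbert.

(** Midpoints of almost minimal elements cannot be much lower than these, so the
parallelogram inequality bounds the distance [d] between almost minimal
elements. The sets [K m] decrease, hence their infima increase to a limit, and
elements of different sets can be compared. This serves twice: for the
projection onto a closed convex set (with [K] constant), and for the L2 norm on
the hulls of the tails of a sequence. *)
Lemma almost_minimal_sequence (R : realType) (V : Type) (mid : V -> V -> V)
    (q : V -> R) (d : V -> V -> R) (K : nat -> set V) (B : R) :
  (forall u, K 0%N u -> 0 <= q u) ->
  (forall m, exists2 u, K m u & q u <= B) ->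
  (forall m p, (m <= p)%N -> K p `<=` K m) ->
  (forall m u v, K m u -> K m v -> K m (mid u v)) ->
  (forall u v, K 0%N u -> K 0%N v ->
    d u v <= 2 * q u + 2 * q v - 4 * q (mid u v)) ->
  forall delta : nat -> R, (forall m, 0 < delta m) ->
  exists v : nat -> V, [/\ (forall m, K m (v m)),
    (forall m p, d (v m) (v p) <= delta m + delta p) &
    forall m u, (forall n, K n u) -> q (v m) <= q u + delta m].
Proof.
move=> q0 KB Kle Kmid dq delta delta0.
pose i m := inf (q @` K m).
have lbK m : has_inf (q @` K m).
  split; first by have [u Ku _] := KB m; exists (q u), u.
  by exists 0 => _ [u Ku <-]; apply: q0; exact: Kle Ku.
have i_le m u : K m u -> i m <= q u.
  by move=> Ku; apply: ge_inf; [exact: (lbK m).2|exists u].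
have i_near m e : 0 < e -> exists2 u, K m u & q u < i m + e.
  move=> e0; have [_ [u Ku <-] h] := inf_adherent e0 (lbK m).
  by exists u.
have iB m : i m <= B.
  by have [u Ku] := KB m; apply: le_trans; exact: i_le.
pose s := sup (range i).
have hs : has_sup (range i).
  by split; [exists (i 0%N), 0%N|exists B => _ [m _ <-]].
have i_s m : i m <= s by apply: sup_upper_bound => //; exists m.
(* beyond the index [N], the infimum is within [delta m / 8] of its limit [s] *)
have idx m : exists N, (m <= N)%N /\ s - delta m / 8 < i N.
  have d8 : 0 < delta m / 8 by rewrite divr_gt0.
  have [_ [N _ <-] hN] := sup_adherent d8 hs.
  exists (maxn m N); split; first exact: leq_maxl.
  apply: lt_le_trans hN _; have [u Ku] := KB (maxn m N).
  move=> _; apply: lb_le_inf; first exact: (lbK _).1.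
  by move=> _ [w Kw <-]; apply: i_le; apply: Kle Kw; exact: leq_maxr.
have [N hN] := choice idx.
have pick m : exists u, K (N m) u /\ q u < i (N m) + delta m / 8.
  by have [|u Ku h] := i_near (N m) (delta m / 8); [rewrite divr_gt0|exists u].
have [v hv] := choice pick.
exists v; split=> [m|m p|m u Ku].
- by apply: Kle (hv m).1; exact: (hN m).1.
- pose n := minn (N m) (N p).
  have Km : K n (v m) by apply: Kle (hv m).1; exact: geq_minl.
  have Kp : K n (v p) by apply: Kle (hv p).1; exact: geq_minr.
  have hin : s - (delta m + delta p) / 8 < i n.
    have := delta0 m; have := delta0 p; have := (hN m).2; have := (hN p).2.
    by rewrite /n /minn; case: ifP => _; lra.
  have := dq _ _ (Kle _ _ (leq0n n) _ Km) (Kle _ _ (leq0n n) _ Kp).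
  have := i_le _ _ (Kmid _ _ _ Km Kp).
  have := (hv m).2; have := (hv p).2; have := i_s (N m); have := i_s (N p).
  have := delta0 m; have := delta0 p.
  by lra.
- have := (hv m).2; have := i_le _ _ (Ku (N m)); have := delta0 m.
  by lra.
Qed.

(** * Separation of a point from a closed convex set *)

Section Separation.
Context {R : realType} {H : completeNormedModType R} (ip : {dot H for idfun}).
Hypothesis Hip : induces_norm ip.

Lemma cvg_sqdist_harmonic (u : nat -> H) :
  (forall m p, `|u m - u p| ^+ 2 <= harmonic m + harmonic p) ->
  cvgn u.
Proof.
move=> hu; apply/cauchy_cvgP/cauchyP => e e0.
have /cvgrPdist_lt/(_ (e ^+ 2 / 2)) := @cvg_harmonic R.
move=> /(_ ltac:(by rewrite divr_gt0 ?exprn_gt0)) [N _ hN].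
exists (u N); change (\forall p \near \oo, ball (u N) e (u p)).
near=> p; rewrite -ball_normE /=.
rewrite -(@ltr_pXn2r _ 2)// ?nnegrE ?(ltW e0)//.
apply: le_lt_trans (hu _ _) _.
have h1 := hN N (leqnn N); have h2 : `|0 - harmonic p| < e ^+ 2 / 2 :> R.
  by apply: hN; near: p; exact: nbhs_infty_ge.
move: h1 h2; rewrite !sub0r !normrN !ger0_norm ?harmonic_ge0// => h1 h2.
by rewrite [ltRHS](splitr (e ^+ 2)); exact: ltrD.
Unshelve. all: by end_near. Qed.

(** The separating vector is [g - v0], where [v0] is the point of [A] nearest to
[g]; it is the limit of an almost minimizing sequence. *)
Lemma separation (A : set H) (g : H) :
  A !=set0 -> closed A -> convex_set A -> ~ A g ->
  exists (e : H) (a : R), a < ip g e /\ forall v, A v -> ip v e <= a.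
Proof.
move=> [a0 Aa0] clA cvA nAg.
have cvx u v (t : R) : 0 <= t <= 1 -> A u -> A v -> A (t *: u + (1 - t) *: v).
  move=> /andP[t0 t1] Au Av.
  have := cvA u v (Itv01 t0 t1); rewrite !inE => /(_ Au Av).
  by [].
pose q v := `|v - g| ^+ 2.
have [||||v [Av dv qv]] := @almost_minimal_sequence R H
    (fun u v => 2^-1 *: (u + v)) q (fun u v => `|u - v| ^+ 2)
    (fun=> A) (q a0) (fun _ _ => sqr_ge0 _) _ _ _ _ harmonic
    (fun=> harmonic_gt0 _).
- by move=> _; exists a0.
- by move=> m p _.
- move=> _ u v Au Av.
  have -> : 2^-1 *: (u + v) = 2^-1 *: u + (1 - 2^-1) *: v.
    by rewrite scalerDr; congr (_ + _ *: _); field.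
  by apply: cvx => //; rewrite invr_ge0 ler0n/= invf_le1 ?ler1n.
- move=> u v _ _; rewrite (_ : u - v = (u - g) - (v - g)); last first.
    by rewrite opprB addrA subrK.
  rewrite (parallelogram Hip) /q.
  rewrite (_ : 2^-1 *: (u + v) - g = 2^-1 *: (u - g + (v - g)))//.
  rewrite addrACA [RHS]scalerDr; congr (_ + _).
  by rewrite -opprD scalerN -mulr2n -(scaler_nat 2 g) scalerA mulVf// scale1r.
have cv : cvgn v := cvg_sqdist_harmonic dv.
have Av0 : A (limn v) by apply: (closed_cvg _ clA) cv; exact: nearW.
set v0 := limn v in Av0.
(* so far [v0] is a limit of almost minimizers; it is a minimizer *)
have v0_min u : A u -> `|v0 - g| ^+ 2 <= `|u - g| ^+ 2.
  move=> Au.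
  have h : (fun m => `|v m - g|) @ \oo --> `|v0 - g|.
    by apply: cvg_norm; apply: cvgB => //; exact: cvg_cst.
  have hq : (fun m => q (v m)) @ \oo --> `|v0 - g| * `|v0 - g|.
    by rewrite /q; under eq_fun do rewrite expr2; exact: cvgM.
  have hu : (fun m => q u + harmonic m) @ \oo --> q u + 0.
    by apply: cvgD; [exact: cvg_cst|exact: cvg_harmonic].
  rewrite expr2 -/(q u) -[leRHS]addr0.
  by apply: (ler_cvg_to hq hu); apply: nearW => m; exact: qv.
exists (g - v0), (ip v0 (g - v0)).
have gv0 : g - v0 != 0.
  by rewrite subr_eq0; apply/eqP => gv0; apply: nAg; rewrite gv0.
split; first by rewrite -subr_gt0 -ipBl Hip exprn_gt0// normr_gt0.
move=> u Au; rewrite -subr_le0 -ipBl; set c := ip _ _.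
(* If [c > 0], moving from [v0] towards [u] by the fraction [t = c / (c + D)]
   decreases the distance to [g]: the gain [2 t c] beats the loss [t ^ 2 D]. *)
rewrite leNgt; apply/negP => c0; pose D := `|u - v0| ^+ 2.
have D0 : 0 <= D by exact: sqr_ge0.
have cD : 0 < c + D by exact: ltr_pwDl.
pose t := c / (c + D).
have t0 : 0 < t by rewrite divr_gt0.
have t1 : t <= 1 by rewrite ler_pdivrMr// mul1r lerDl.
have := v0_min _ (cvx _ _ t ltac:(by rewrite ltW) Au Av0).
rewrite (_ : t *: u + _ - g = t *: (u - v0) - (g - v0)); last first.
  rewrite opprB scalerBr scalerBl scale1r !addrA; congr (_ - _).
  by rewrite addrAC.
rewrite -(normrN (v0 - g)) opprB (normB_sqr Hip (t *: _)) ipZl -/c normrZ exprMn -/D.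
rewrite ger0_norm ?(ltW t0)// => hle.
have htD : t * D <= c.
  by rewrite /t mulrAC ler_pdivrMr// ler_pM2l// lerDr ltW.
have : t * (t * D) <= t * c by rewrite ler_pM2l.
have : 0 < t * c by rewrite mulr_gt0.
by move: hle; rewrite expr2 -mulrA; lra.
Qed.

Lemma continuous_ip e : continuous ((ip e : H -> R) : H -> R^o).
Proof.
have -> : (ip e : H -> R) = ip^~ e by apply/funext => v; rewrite ip_sym.
by move=> u; exact: (cvg_ipl Hip).
Qed.

Lemma halfspace_weakly_closed (e : H) (a : R) :
  weakly_closed [set v : H | a <= ip v e].
Proof.
pose phi : {linear H -> R^o} := ip e.
pose Phi : {phi : {linear H -> R^o} | continuous phi} :=
  exist _ phi (@continuous_ip e).
have cphi : continuous (phi : weak_space H -> R^o).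
  move=> x; have /cvg_sup/(_ Phi) h : nbhs x --> (x : weak_space H) by exact: cvg_id.
  move=> U /(@initial_continuous _ _ (phi : H -> R^o) x) hU.
  exact: h hU.
rewrite /weakly_closed.
have -> : [set v : H | a <= ip v e] = phi @^-1` [set z | a <= z].
  by apply/seteqP; split => v /=; rewrite ip_sym.
by apply: preimage_closed => //; exact: closed_ge.
Qed.
End Separation.

(** * Integrals without Borel measurability *)

Section LowerIntegral.
Local Open Scope ereal_scope.
Context d (X : measurableType d) (R : realType).
Variable mu : {measure set X -> \bar R}.

(** The integral of a nonnegative function is a supremum over the simple
functions below it, so it is monotone on all functions. *)
Lemma integral_mono_nonmeasurable (D : set X) (f1 f2 : X -> \bar R) :
  (forall x, D x -> 0 <= f1 x) -> (forall x, D x -> f1 x <= f2 x) ->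
  \int[mu]_(x in D) f1 x <= \int[mu]_(x in D) f2 x.
Proof.
move=> f10 f12.
have f20 x : D x -> 0 <= f2 x by move=> Dx; apply: le_trans (f12 x Dx); exact: f10.
rewrite !ge0_integralE//; apply: ereal_sup_le => _ [h /= hf <-].
exists h => //= x; apply: le_trans (hf x) _.
by rewrite !patchE; case: ifPn => // /set_mem; exact: f12.
Qed.

(** An almost everywhere limit of Borel functions need not be Borel, and such
limits occur in the definition of the Bochner integral. The proof sandwiches
[f] between [g] outside of the null set and [g] set to [+oo] on it. *)
Lemma integral_ae_eq_nonmeasurable (D : set X) (f g : X -> \bar R) :
  measurable D -> (forall x, D x -> 0 <= f x) -> (forall x, D x -> 0 <= g x) ->
  measurable_fun D g -> {ae mu, forall x, D x -> f x = g x} ->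
  \int[mu]_(x in D) f x = \int[mu]_(x in D) g x.
Proof.
move=> mD f0 g0 mg [N [mN N0 subN]].
have fg x : D x -> ~ N x -> f x = g x.
  by move=> Dx; apply: contra_notP => fg; apply: subN => /= /(_ Dx).
apply/eqP; rewrite eq_le; apply/andP; split.
- pose G x := if x \in N then +oo else g x.
  have mG : measurable_fun D G.
    apply: measurable_fun_if => //=.
    + apply: (measurable_fun_bool true).
      rewrite (_ : _ @^-1` _ = N); first exact: measurableI.
      by apply/seteqP; split => x /=; [move=> /set_mem|move=> /mem_set ->].
    + apply: measurable_funS mg => //.
  rewrite -(@ge0_ae_eq_integral _ _ _ mu D G g)//.
  + apply: integral_mono_nonmeasurable => // x Dx; rewrite /G.
    by case: ifPn => [_|/negP xN]; [rewrite leey|rewrite fg// => /mem_set].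
  + by move=> x Dx; rewrite /G; case: ifPn => // _; exact: g0.
  + exists N; split => // x /=; apply: contra_notP => xN.
    by rewrite /G memNset.
- rewrite (ge0_negligible_integral mN mD)// setDE integral_mkcondr.
  apply: integral_mono_nonmeasurable => x Dx; rewrite patchE.
    by case: ifPn => // _; exact: g0.
  by case: ifPn => [/set_mem Nx|_]; [rewrite fg|exact: f0].
Qed.
End LowerIntegral.

(** * Integrals of bounded Borel functions over segments *)

Section BoundedIntegrals.
Context {R : realType}.
Local Notation mu := (@lebesgue_measure R).

Lemma ae_imp (P Q : R -> Prop) : (forall t, P t -> Q t) ->
  {ae mu, forall t, P t} -> {ae mu, forall t, Q t}.
Proof. by move=> PQ; apply: (@filterS _ _ (ae_filter_ringOfSetsType mu)). Qed.

Lemma ae_and (P Q : R -> Prop) :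
  {ae mu, forall t, P t} -> {ae mu, forall t, Q t} ->
  {ae mu, forall t, P t /\ Q t}.
Proof. exact: (@filterI _ _ (ae_filter_ringOfSetsType mu)). Qed.

Lemma ae_all_nat (P : nat -> R -> Prop) :
  (forall n, {ae mu, forall t, P n t}) -> {ae mu, forall t, forall n, P n t}.
Proof.
move=> h; have := negligible_bigcup h.
by apply: negligibleS => t /existsNP[n nP]; exists n.
Qed.

Implicit Types (f g : R -> R) (a b c : R).

Definition bounded_borel f := measurable_fun [set: measurableTypeR R] f /\
  exists M, forall t, `|f t| <= M.

Definition segint a b f : R := \int[mu]_(t in `[a, b]) f t.

Lemma bounded_borel_integrable f (D : set (measurableTypeR R)) : measurable D ->
  (mu D < +oo)%E -> bounded_borel f -> mu.-integrable D (EFin \o f).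
Proof.
move=> mD Dfin [mf [M fM]].
apply: measurable_bounded_integrable => //; first exact: measurable_funTS.
exists M; split; first exact: num_real.
by move=> x Mx t _ /=; rewrite (le_trans (fM t))// ltW.
Qed.

Lemma lebesgue_measure_itv_fin a b : (mu `[a, b] < +oo)%E.
Proof. by rewrite lebesgue_measure_itv/=; case: ifPn => _; rewrite -?EFinB ltry. Qed.

Lemma bounded_borel_integrable_itv f a b : bounded_borel f ->
  mu.-integrable `[a, b] (EFin \o f).
Proof.
move=> bf; apply: bounded_borel_integrable => //; exact: lebesgue_measure_itv_fin.
Qed.

Lemma bounded_borel_integrable_ocitv f a b : bounded_borel f -> mu.-integrable `]a,
  b] (EFin \o f).
Proof.
move=> bf; apply: bounded_borel_integrable => //.
by rewrite lebesgue_measure_itv/=; case: ifPn => _; rewrite -?EFinB ltry.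
Qed.

Lemma bounded_borel_cst c : bounded_borel (fun=> c).
Proof. by split; [exact: measurable_cst|exists `|c|]. Qed.

Lemma bounded_borelD f g : bounded_borel f -> bounded_borel g ->
  bounded_borel (fun t => f t + g t).
Proof.
move=> [mf [M fM]] [mg [N gN]]; split; first exact: measurable_funD.
by exists (M + N) => t; apply: le_trans (ler_normD _ _) _; exact: lerD.
Qed.

Lemma bounded_borelM f g : bounded_borel f -> bounded_borel g ->
  bounded_borel (fun t => f t * g t).
Proof.
move=> [mf [M fM]] [mg [N gN]]; split; first exact: measurable_funM.
by exists (M * N) => t; rewrite normrM ler_pM.
Qed.

Lemma bounded_borelB f g : bounded_borel f -> bounded_borel g ->
  bounded_borel (fun t => f t - g t).
Proof.
move=> bf bg; have := bounded_borelD bf (bounded_borelM (bounded_borel_cst (-1)) bg).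
by under eq_fun do rewrite mulN1r.
Qed.

Lemma bounded_borel_norm f : bounded_borel f -> bounded_borel (fun t => `|f t|).
Proof.
move=> [mf [M fM]]; split; first exact: measurableT_comp.
by exists M => t; rewrite normr_id.
Qed.

Lemma segint_ge0 a b f : (forall t, 0 <= f t) -> 0 <= segint a b f.
Proof. by move=> f0; exact: Rintegral_ge0. Qed.

Lemma segintD a b f g : bounded_borel f -> bounded_borel g ->
  segint a b (fun t => f t + g t) = segint a b f + segint a b g.
Proof. by move=> bf bg; apply: RintegralD => //;
  exact: bounded_borel_integrable_itv. Qed.

Lemma segintB a b f g : bounded_borel f -> bounded_borel g ->
  segint a b (fun t => f t - g t) = segint a b f - segint a b g.
Proof. by move=> bf bg; apply: RintegralB => //;
  exact: bounded_borel_integrable_itv. Qed.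

Lemma segintZ a b f c : bounded_borel f ->
  segint a b (fun t => c * f t) = c * segint a b f.
Proof. by move=> bf; apply: RintegralZl => //;
  exact: bounded_borel_integrable_itv. Qed.

Lemma segint_le a b f g : bounded_borel f -> bounded_borel g ->
  (forall t, a <= t <= b -> f t <= g t) -> segint a b f <= segint a b g.
Proof.
move=> bf bg fg; apply: le_Rintegral => [|||t].
- by [].
- exact: bounded_borel_integrable_itv.
- exact: bounded_borel_integrable_itv.
- by rewrite /= in_itv/=; exact: fg.
Qed.

Lemma segint_abs a b f : bounded_borel f ->
  `|segint a b f| <= segint a b (fun t => `|f t|).
Proof.
by move=> bf; apply: le_normr_Rintegral => //; exact: bounded_borel_integrable_itv.
Qed.

Lemma segint_cst a b c : a <= b -> segint a b (fun=> c) = c * (b - a).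
Proof.
move=> ab; rewrite /segint Rintegral_cst//= lebesgue_measure_itv/= lte_fin.
by case: ltgtP ab => //= -> _; rewrite subrr.
Qed.

Lemma segint_same a f : segint a a f = 0.
Proof. by rewrite /segint set_itv1 Rintegral_set1. Qed.

Lemma segint_split a b c f : a <= b -> b <= c -> bounded_borel f ->
  segint a c f = segint a b f + segint b c f.
Proof.
move=> ab bc bf; apply/eqP; rewrite addrC -subr_eq; apply/eqP.
rewrite /segint Rintegral_itvB ?bnd_simp//; last exact: bounded_borel_integrable_itv.
rewrite Rintegral_itv_obnd_cbnd//.
exact: bounded_borel_integrable_ocitv.
Qed.

Lemma segint_eq a b f g : (forall t, a < t <= b -> f t = g t) ->
  bounded_borel f -> bounded_borel g -> segint a b f = segint a b g.
Proof.
move=> fg bf bg; rewrite /segint -!Rintegral_itv_obnd_cbnd; last 2 first.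
- exact: bounded_borel_integrable_ocitv.
- exact: bounded_borel_integrable_ocitv.
by apply: eq_Rintegral => t; rewrite inE/= in_itv/=; exact: fg.
Qed.

Lemma segint_EFin a b f : bounded_borel f ->
  (\int[mu]_(t in `[a, b]) (f t)%:E = (segint a b f)%:E)%E.
Proof.
move=> bf; rewrite /segint/Rintegral fineK//.
by apply: integrable_fin_num => //; exact: bounded_borel_integrable_itv.
Qed.

Lemma segint_cvg a b (f_ : nat -> R -> R) f M :
  (forall n, bounded_borel (f_ n)) -> bounded_borel f ->
  (forall n t, a <= t <= b -> `|f_ n t| <= M) ->
  {ae mu, forall t, a <= t <= b -> f_^~ t @ \oo --> f t} ->
  segint a b (f_ n) @[n --> \oo] --> segint a b f.
Proof.
move=> bf_ bf fM cf.
have [] := @dominated_convergence _ _ _ mu `[a, b] _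
  (fun n t => (f_ n t)%:E) (EFin \o f) (cst M%:E).
- by [].
- by move=> n; apply/measurable_EFinP; apply: measurable_funTS; exact: (bf_ n).1.
- by apply/measurable_EFinP; apply: measurable_funTS; exact: bf.1.
- by apply: ae_imp cf => t h; rewrite /= in_itv/= => /h ft; apply: cvg_EFin;
    [exact: nearW|exact: ft].
- by apply: (bounded_borel_integrable_itv a b (bounded_borel_cst M)).
- apply: aeW => t n; rewrite /= in_itv/= => /fM.
  by rewrite lee_fin; exact.
move=> _ _; rewrite segint_EFin// => h.
have {}h : (fun n => (segint a b (f_ n))%:E) @ \oo --> (segint a b f)%:E.
  rewrite (_ : (fun n => _) = (fun n => \int[mu]_(t in `[a, b]) (f_ n t)%:E)%E)//.
  by apply/funext => n; rewrite segint_EFin.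
by have /fine_cvgP[] := h.
Qed.

Lemma segint_derivable f : bounded_borel f -> {ae mu, forall t, 0 < t ->
  derivable (fun x => segint 0 x f) t 1 /\ derive1 (fun x => segint 0 x f) t = f t}.
Proof.
move=> bf; have lf : locally_integrable [set: R] f.
  split; [exact: bf.1|exact: openT|].
  move=> K _ cK.
  have := bounded_borel_integrable (compact_measurable cK) (compact_finite_measure cK) bf.
  by move=> /integrableP[].
have := @FTC1 R f (BLeft 0) (fun y => bounded_borel_integrable_itv 0 y bf) lf.
by apply: ae_imp => t /= ht t0; exact: ht.
Qed.

End BoundedIntegrals.

Lemma segint_sum (R : realType) (a b : R) (I : Type) (l : seq I) (F : I -> R -> R) :
  (forall i, bounded_borel (F i)) ->
  segint a b (fun t => \sum_(i <- l) F i t) = \sum_(i <- l) segint a b (F i).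
Proof.
move=> bF.
have bsum l' : bounded_borel (fun t => \sum_(i <- l') F i t).
  elim: l' => [|i l' IH].
    by under eq_fun do rewrite big_nil; exact: bounded_borel_cst.
  by under eq_fun do rewrite big_cons; exact: bounded_borelD.
elim: l => [|i l IH].
  rewrite big_nil; under eq_fun do rewrite big_nil.
  by rewrite /segint Rintegral_cst// mul0r.
by under eq_fun do rewrite big_cons; rewrite big_cons segintD// IH.
Qed.

(** * Limits of simple functions *)

Section SimpleFunctions.
Context {R : realType} {H : normedModType R} (ip : {dot H for idfun}).
Hypothesis Hip : induces_norm ip.
Local Notation mu := (@lebesgue_measure R).
Implicit Types (s r : simple_fun H) (u v : R -> H) (A : set (measurableTypeR R)).

Definition sf_add s r : simple_fun H.
Proof.
refine (@SimpleFun R H (sf_size s + sf_size r)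
  (fun i => match fintype.split i with inl j => sf_set j | inr j => sf_set j end)
  (fun i => match fintype.split i with inl j => sf_val j | inr j => sf_val j end) _).
by move=> i; case: (fintype.split i) => j; exact: sf_measurable.
Defined.

Lemma sf_addE s r t : sf_eval (sf_add s r) t = sf_eval s t + sf_eval r t.
Proof.
rewrite /sf_eval /= big_split_ord /=; congr (_ + _); apply: eq_bigr => i _.
  by case: split_ordP => j; [move/lshift_inj->|move/eqP; rewrite eq_lrshift].
by case: split_ordP => j; [move/eqP; rewrite eq_rlshift|move/rshift_inj->].
Qed.

Definition sf_restrict A (mA : measurable A) (c : R) s : simple_fun H :=
  @SimpleFun R H (sf_size s) (fun i => A `&` @sf_set R H s i)
    (fun i => c *: sf_val i)
    (fun i => measurableI _ _ mA (@sf_measurable R H s i)).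

Lemma sf_restrictE A (mA : measurable A) c s t :
  sf_eval (sf_restrict mA c s) t = \1_A t *: (c *: sf_eval s t).
Proof.
rewrite /sf_eval /= !scaler_sumr; apply: eq_bigr => i _.
by rewrite indicI /= !scalerA; congr (_ *: _); ring.
Qed.

Lemma sf_bounded s : exists M, forall t, `|sf_eval s t| <= M.
Proof.
exists (\sum_(i < sf_size s) `|@sf_val R H s i|) => t.
apply: le_trans (ler_norm_sum _ _ _) _; apply: ler_sum => i _.
rewrite normrZ ler_piMl// indicE; case: (_ \in _); rewrite ?normr1 ?normr0//.
Qed.

(** The inner product of simple functions is a polynomial in indicators. *)
Lemma measurable_ip_sf s r :
  measurable_fun [set: measurableTypeR R] (fun t => ip (sf_eval s t) (sf_eval r t)).
Proof.
rewrite (_ : (fun t => _) = (fun t => \sum_(i < sf_size s) \sum_(j < sf_size r)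
    (\1_(@sf_set R H s i) t * (\1_(@sf_set R H r j) t *
      ip (@sf_val R H s i) (@sf_val R H r j))))).
  apply: measurable_sum => i; apply: measurable_sum => j.
  apply: measurable_funM; first by apply: measurable_indic; exact: sf_measurable.
  apply: measurable_funM; last exact: measurable_cst.
  by apply: measurable_indic; exact: sf_measurable.
apply/funext => t; rewrite /sf_eval ip_suml; apply: eq_bigr => i _.
rewrite ip_sym ip_suml; apply: eq_bigr => j _.
by rewrite ipZl ip_sym ipZl; ring.
Qed.

(** Borel maps with separable range, encoded as the closure of the simple
functions under pointwise limits. In this form, stability under limits is free
and the other properties follow by induction. *)
Inductive strong_borel : (R -> H) -> Prop :=
| strong_borel_sf s : strong_borel (sf_eval s)
| strong_borel_lim (us : nat -> R -> H) u : (forall n, strong_borel (us n)) ->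
    (forall t, us^~ t @ \oo --> u t) -> strong_borel u.

Lemma strong_borel_cst (c : H) : strong_borel (fun=> c).
Proof.
pose s := @SimpleFun R H 1 (fun=> setT) (fun=> c) (fun=> measurableT).
rewrite (_ : (fun=> c) = sf_eval s); first exact: strong_borel_sf.
by apply/funext => t; rewrite /sf_eval big_ord1 /= indicT scale1r.
Qed.

Lemma strong_borelD u v : strong_borel u -> strong_borel v ->
  strong_borel (fun t => u t + v t).
Proof.
move=> mu_; elim: mu_ v => {u} [s|us u _ IH uu] v mv.
  elim: mv => {v} [r|vs v _ IH vv].
    rewrite (_ : (fun t => _) = sf_eval (sf_add s r)); first exact: strong_borel_sf.
    by apply/funext => t; rewrite sf_addE.
  by apply: (strong_borel_lim IH) => t; apply: cvgD => //; exact: cvg_cst.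
apply: (strong_borel_lim (fun n => IH n v mv)) => t.
by apply: cvgD => //; exact: cvg_cst.
Qed.

Lemma strong_borel_indicZ A c u : measurable A -> strong_borel u ->
  strong_borel (fun t => \1_A t *: (c *: u t)).
Proof.
move=> mA; elim=> {u} [s|us u _ IH uu].
  rewrite (_ : (fun t => _) = sf_eval (sf_restrict mA c s));
    first exact: strong_borel_sf.
  by apply/funext => t; rewrite sf_restrictE.
by apply: (strong_borel_lim IH) => t; do 2 apply: cvgZr.
Qed.

Lemma strong_borelZ c u : strong_borel u -> strong_borel (fun t => c *: u t).
Proof.
move=> mu_; have := strong_borel_indicZ c (@measurableT _ (measurableTypeR R)) mu_.
by under eq_fun do rewrite indicT scale1r.
Qed.

Lemma strong_borel_indic A u : measurable A -> strong_borel u ->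
  strong_borel (fun t => \1_A t *: u t).
Proof.
by move=> mA mu_; have := strong_borel_indicZ 1 mA mu_;
  under eq_fun do rewrite scale1r.
Qed.

Lemma strong_borelB u v : strong_borel u -> strong_borel v ->
  strong_borel (fun t => u t - v t).
Proof.
move=> mu_ mv; have := strong_borelD mu_ (strong_borelZ (-1) mv).
by under eq_fun do rewrite scaleN1r.
Qed.

Lemma strong_borel_sum n (u : nat -> R -> H) : (forall k, strong_borel (u k)) ->
  strong_borel (fun t => \sum_(k < n) u k t).
Proof.
move=> hu; elim: n => [|n IH].
  by under eq_fun do rewrite big_ord0; exact: strong_borel_cst.
by under eq_fun do rewrite big_ord_recr; exact: strong_borelD.
Qed.

Lemma strong_borel_ip_measurable u v : strong_borel u -> strong_borel v ->
  measurable_fun [set: measurableTypeR R] (fun t => ip (u t) (v t)).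
Proof.
move=> mu_; elim: mu_ v => {u} [s|us u _ IH uu] v mv.
  elim: mv => {v} [r|vs v _ IH vv]; first exact: measurable_ip_sf.
  apply: (measurable_fun_cvg IH) => t _ /=.
  by apply: (cvg_ip2 Hip) => //; exact: cvg_cst.
apply: (measurable_fun_cvg (fun n => IH n v mv)) => t _ /=.
by apply: (cvg_ip2 Hip) => //; exact: cvg_cst.
Qed.

Lemma strong_borel_separable u : strong_borel u ->
  exists d : nat -> H, forall t e, 0 < e -> exists j, `|u t - d j| < e.
Proof.
elim=> {u} [s|us u _ IH uu].
  pose d j : H := if unpickle j is Some J
    then \sum_(i in (J : {set 'I_(sf_size s)})) @sf_val R H s i else 0.
  exists d => t e e0.
  pose J : {set 'I_(sf_size s)} := [set i | t \in @sf_set R H s i]%SET.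
  exists (pickle J); rewrite /d pickleK /sf_eval.
  rewrite (_ : \sum_(i < _) _ = \sum_(i in J) sf_val i).
    by rewrite subrr normr0.
  rewrite [RHS]big_mkcond; apply: eq_bigr => i _ /=.
  by rewrite inE indicE; case: (_ \in _); rewrite ?scale1r ?scale0r.
have [d hd] := choice IH.
pose D p : H := if unpickle p is Some (n, j) then d n j else 0.
exists D => t e e0; have e2 : 0 < e / 2 by rewrite divr_gt0.
move/cvgrPdist_lt : (uu t) => /(_ _ e2)[N _ /(_ N (leqnn _)) hN].
have [j hj] := hd N t _ e2.
exists (pickle (N, j)); rewrite /D pickleK [ltRHS]splitr.
rewrite -(subrK (us N t) (u t)) -addrA.
by apply: le_lt_trans (ler_normD _ _) _; exact: ltrD.
Qed.

Lemma strong_borel_norm_measurable u : strong_borel u ->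
  measurable_fun [set: measurableTypeR R] (fun t => `|u t|).
Proof.
move=> mu_.
rewrite (_ : (fun t => _) = @Num.sqrt R \o (fun t => ip (u t) (u t))).
  apply: measurableT_comp; last exact: strong_borel_ip_measurable.
  by apply: continuous_measurable_fun; exact: sqrt_continuous.
by apply/funext => t /=; rewrite Hip sqrtr_sqr normr_id.
Qed.

Definition norm_bounded u := exists M, forall t, `|u t| <= M.

Lemma bounded_borel_ip u v : strong_borel u -> norm_bounded u -> strong_borel v ->
  norm_bounded v ->
  bounded_borel (fun t => ip (u t) (v t)).
Proof.
move=> mu_ [M uM] mv [N vN]; split; first exact: strong_borel_ip_measurable.
exists (M * N) => t; apply: le_trans (ip_le_norm Hip _ _) _.
by apply: ler_pM.
Qed.

Lemma bounded_borel_ip_cst u e : strong_borel u -> norm_bounded u ->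
  bounded_borel (fun t => ip (u t) e).
Proof.
by move=> mu_ bu; apply: bounded_borel_ip => //;
  [exact: strong_borel_cst|exists `|e|].
Qed.

Lemma bounded_borel_vnorm u : strong_borel u -> norm_bounded u ->
  bounded_borel (fun t => `|u t|).
Proof.
move=> mu_ [M uM]; split; first exact: strong_borel_norm_measurable.
by exists M => t; rewrite normr_id.
Qed.

Lemma norm_boundedB u v : norm_bounded u -> norm_bounded v ->
  norm_bounded (fun t => u t - v t).
Proof.
move=> [M uM] [N vN]; exists (M + N) => t.
by apply: le_trans (ler_normB _ _) _; exact: lerD.
Qed.

Lemma segint_ip_le a b u e : strong_borel u -> norm_bounded u ->
  `|segint a b (fun t => ip (u t) e)| <= `|e| * segint a b (fun t => `|u t|).
Proof.
move=> mu_ bu; apply: le_trans (segint_abs _ _ (bounded_borel_ip_cst e mu_ bu)) _.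
rewrite -segintZ; last exact: bounded_borel_vnorm.
apply: segint_le.
- exact/bounded_borel_norm/bounded_borel_ip_cst.
- by apply: bounded_borelM; [exact: bounded_borel_cst|exact: bounded_borel_vnorm].
- by move=> t _; rewrite mulrC; exact: (ip_le_norm Hip).
Qed.

Lemma ip_sf_int a b s e :
  ip (sf_int a b s) e = segint a b (fun t => ip (sf_eval s t) e).
Proof.
rewrite /sf_int ip_suml.
under [in RHS]eq_fun do rewrite /sf_eval ip_suml.
have bi i : bounded_borel (fun t => ip (\1_(@sf_set R H s i) t *: @sf_val R H s i) e).
  under eq_fun do rewrite ipZl.
  apply: bounded_borelM; last exact: bounded_borel_cst.
  split; first by apply: measurable_indic; exact: sf_measurable.
  by exists 1 => t; rewrite indicE; case: (_ \in _); rewrite ?normr1 ?normr0.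
rewrite segint_sum//; apply: eq_bigr => i _.
rewrite [RHS](_ : _ = segint a b (fun t => ip (sf_val i) e * \1_(sf_set i) t));
  last first.
  by congr segint; apply/funext => t; rewrite ipZl mulrC.
rewrite segintZ; last first.
  split; first by apply: measurable_indic; exact: sf_measurable.
  by exists 1 => t; rewrite indicE; case: (_ \in _); rewrite ?normr1 ?normr0.
rewrite ipZl mulrC; congr (_ * _).
rewrite /segint /Rintegral integral_indic//; last exact: sf_measurable.
by rewrite setIC.
Qed.


End SimpleFunctions.

(** Pair [v] with itself, bound the pairing inside the integral, and divide by
[|v|]. *)
Lemma norm_le_segint (R : realType) (H : normedModType R) (ip : {dot H for idfun})
    (Hip : induces_norm ip) (a b : R) (v : H) (u : R -> H) :
  strong_borel u -> norm_bounded u ->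
  (forall e, ip v e = segint a b (fun t => ip (u t) e)) ->
  `|v| <= segint a b (fun t => `|u t|).
Proof.
move=> mu_ bu vE; have [->|v0] := eqVneq v 0; first by rewrite normr0 segint_ge0.
rewrite -(@ler_pM2l _ `|v|) ?normr_gt0// -expr2 -Hip vE.
apply: le_trans (ler_norm _) _; exact: (segint_ip_le Hip).
Qed.

Lemma norm_le_segint_cst (R : realType) (H : normedModType R)
    (ip : {dot H for idfun}) (Hip : induces_norm ip)
    (a b : R) (v : H) (u : R -> H) (M : R) :
  a <= b -> strong_borel u -> (forall t, `|u t| <= M) ->
  (forall e, ip v e = segint a b (fun t => ip (u t) e)) -> `|v| <= M * (b - a).
Proof.
move=> ab mu_ uM vE; have bu : norm_bounded u by exists M.
apply: le_trans (norm_le_segint Hip mu_ bu vE) _; rewrite -segint_cst//.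
by apply: segint_le => //; [exact: (bounded_borel_vnorm Hip)|exact: bounded_borel_cst].
Qed.

(** * Scalar description of the Bochner integral *)

Section BochnerIntegral.
Context {R : realType} {H : completeNormedModType R} (ip : {dot H for idfun}).
Hypothesis Hip : induces_norm ip.
Local Notation mu := (@lebesgue_measure R).

Lemma sf_truncate (s : simple_fun H) (A : set (measurableTypeR R)) (M : R) :
  measurable A -> exists r : simple_fun H, forall t,
    sf_eval r t = if (t \in A) && (`|sf_eval s t| <= M) then sf_eval s t else 0.
Proof.
move=> mA; pose B := A `&` ((fun t => `|sf_eval s t|) @^-1` `]-oo, M]).
have mB : measurable B.
  apply: measurableI => //; rewrite -[X in measurable X]setTI.
  by apply: (strong_borel_norm_measurable Hip (strong_borel_sf s)).
exists (sf_restrict mB 1 s) => t; rewrite sf_restrictE scale1r indicE.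
rewrite (_ : (t \in B) = (t \in A) && (`|sf_eval s t| <= M)).
  by case: ifPn => _; rewrite ?scale1r ?scale0r.
apply/idP/idP => [/set_mem[At]|/andP[/set_mem At sM]].
  by rewrite /= in_itv/= => sM; rewrite mem_set.
by apply/mem_set; split => //=; rewrite in_itv.
Qed.

Lemma norm_sf_intB a b (s r : simple_fun H) :
  `|sf_int a b s - sf_int a b r| <= segint a b (fun t => `|sf_eval s t - sf_eval r t|).
Proof.
have ms := strong_borel_sf s; have mr := strong_borel_sf r.
have bs : norm_bounded (sf_eval s) := sf_bounded s.
have br : norm_bounded (sf_eval r) := sf_bounded r.
apply: (norm_le_segint Hip (u := fun t => sf_eval s t - sf_eval r t)).
- exact: strong_borelB.
- exact: norm_boundedB.
- move=> e; rewrite ipBl !ip_sf_int -segintB; [|exact: (bounded_borel_ip_cst Hip)..].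
  by congr segint; apply/funext => t; rewrite ipBl.
Qed.

(** The Bochner integral is defined as a chosen value, so its existence has to be
proved before anything is known of it. Truncating the approximating simple
functions at the level [|M| + 1] makes dominated convergence available, and
their integrals form a Cauchy sequence by [norm_sf_intB]. The version [u] is
[g] set to zero on a null set. *)
Lemma bochner_representation (T M : R) (g : R -> H) :
  strongly_measurable 0 T g -> {ae mu, forall t, 0 <= t <= T -> `|g t| <= M} ->
  exists u : R -> H, [/\ strong_borel u, forall t, `|u t| <= `|M|,
    {ae mu, forall t, 0 <= t <= T -> u t = g t} &
    forall a b e, 0 <= a -> a <= b -> b <= T ->
      ip (bochner_int a b g) e = segint a b (fun t => ip (u t) e)].
Proof.
move=> [s cs] bg; have [N [mN N0 subN]] := ae_and cs bg.
have nN t : ~ N t -> 0 <= t <= T ->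
    (fun n => sf_eval (s n) t) @ \oo --> g t /\ `|g t| <= M.
  move=> Nt tT; have : ~ ~ ((0 <= t <= T -> sf_eval (s n) t @[n --> \oo] --> g t) /\
    (0 <= t <= T -> `|g t| <= M)).
    by move=> h; apply: Nt; exact: subN.
  by move=> /contrapT[h1 h2]; split; [exact: h1|exact: h2].
pose A : set (measurableTypeR R) := `[0, T] `\` N.
have mA : measurable A by exact: measurableD.
pose u t := \1_A t *: g t.
have uA t : A t -> u t = g t by move=> At; rewrite /u indicE mem_set// scale1r.
have unA t : ~ A t -> u t = 0 by move=> At; rewrite /u indicE memNset// scale0r.
have As t : A t -> (fun n => sf_eval (s n) t) @ \oo --> g t /\ `|g t| <= M.
  by move=> [+ Nt]; rewrite /= in_itv/=; exact: nN.
have uM t : `|u t| <= `|M|.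
  have [At|nAt] := pselect (A t); last by rewrite unA// normr0.
  by rewrite uA//; apply: le_trans (ler_norm M); exact: (As t At).2.
have [r rE] := choice (fun n => sf_truncate (s n) (`|M| + 1) mA).
have ru t : (fun n => sf_eval (r n) t) @ \oo --> u t.
  have [At|nAt] := pselect (A t); last first.
    rewrite unA//; under eq_fun do rewrite rE memNset//=; exact: cvg_cst.
  have [sg gM] := As t At.
  rewrite uA//; apply: cvg_trans sg; apply: near_eq_cvg.
  have : \forall n \near \oo, `|g t - sf_eval (s n) t| < 1.
    by move/cvgrPdist_lt : (As t At).1; apply.
  apply: filterS => n hn; rewrite rE mem_set//= ifT//.
  rewrite -[sf_eval _ _](subKr (g t)); apply: le_trans (ler_normB _ _) _.
  by apply: lerD; [exact: le_trans gM (ler_norm _)|exact: ltW].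
have rM n t : `|sf_eval (r n) t| <= `|M| + 1.
  by rewrite rE; case: ifPn => [/andP[]//|_]; rewrite normr0 addr_ge0.
have mu_ : strong_borel u by apply: (strong_borel_lim (fun n => strong_borel_sf (r n))).
have bu : norm_bounded u by exists `|M|.
have ug : {ae mu, forall t, 0 <= t <= T -> u t = g t}.
  exists N; split => // t /=; apply: contra_notP => Nt tT.
  by apply: uA; split => //=; rewrite in_itv.
exists u; split => // a b e a0 ab bT.
have abT t : a <= t <= b -> 0 <= t <= T.
  by move=> /andP[at_ tb]; rewrite (le_trans a0)//= (le_trans tb).
(* [g] and its Borel version [u] have the same distance to simple functions *)
have intE (q : simple_fun H) :
    (\int[mu]_(t in `[a, b]) (`|g t - sf_eval q t|)%:E =
     (segint a b (fun t => `|u t - sf_eval q t|))%:E)%E.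
  have bq : bounded_borel (fun t => `|u t - sf_eval q t|).
    apply: (bounded_borel_vnorm Hip).
      by apply: strong_borelB => //; exact: strong_borel_sf.
    by apply: norm_boundedB => //; exact: sf_bounded.
  rewrite -segint_EFin//; apply: integral_ae_eq_nonmeasurable.
  - by [].
  - by move=> t _ /=; rewrite lee_fin.
  - by move=> t _ /=; rewrite lee_fin.
  - by apply/measurable_EFinP; apply: measurable_funTS; exact: bq.1.
  - by apply: ae_imp ug => t h; rewrite /= in_itv/= => /abT/h ->.
have segint_r : segint a b (fun t => `|u t - sf_eval (r n) t|) @[n --> \oo] --> (0 : R).
  have -> : 0 = segint a b (fun=> 0) :> R by rewrite segint_cst// mul0r.
  apply: (@segint_cvg _ _ _ _ _ (`|M| + (`|M| + 1))).
  - move=> n; apply: (bounded_borel_vnorm Hip).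
      by apply: strong_borelB => //; exact: strong_borel_sf.
    by apply: norm_boundedB => //; exact: sf_bounded.
  - exact: bounded_borel_cst.
  - by move=> n t _; rewrite normr_id; apply: le_trans (ler_normB _ _) _; exact: lerD.
  - apply: aeW => t _; have -> : 0 = `|u t - u t| :> R by rewrite subrr normr0.
    by apply: cvg_norm; apply: cvgB (ru t); exact: cvg_cst.
have bochner_ex : exists v, is_bochner_integral a b g v.
  have cr : cvgn (fun n => sf_int a b (r n)).
    apply/cauchy_cvgP/cauchyP => e' e0.
    move/cvgrPdist_lt : segint_r => /(_ (e' / 2));
      rewrite divr_gt0// => /(_ isT)[N1 _ hN1].
    exists (sf_int a b (r N1)).
    change (\forall p \near \oo, ball (sf_int a b (r N1)) e' (sf_int a b (r p))).
    exists N1 => // p /= N1p; rewrite -ball_normE /=.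
    apply: le_lt_trans (norm_sf_intB _ _ _ _) _.
    have := hN1 p N1p; have := hN1 N1 (leqnn _); rewrite !sub0r !normrN => h1 h2.
    have bm q : bounded_borel (fun t => `|u t - sf_eval (r q) t|).
      apply: (bounded_borel_vnorm Hip).
        by apply: strong_borelB => //; exact: strong_borel_sf.
      by apply: norm_boundedB => //; exact: sf_bounded.
    apply: (@le_lt_trans _ _ (segint a b (fun t => `|u t - sf_eval (r N1) t|
        + `|u t - sf_eval (r p) t|))).
      apply: segint_le.
      - apply: (bounded_borel_vnorm Hip).
          by apply: strong_borelB; exact: strong_borel_sf.
        by apply: norm_boundedB; exact: sf_bounded.
      - exact: bounded_borelD.
      - move=> t _; rewrite (distrC (u t)) (le_trans _ (ler_normD _ _))//.
        by rewrite addrA subrK.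
    rewrite segintD//; apply: le_lt_trans (ler_norm _) _.
    by apply: le_lt_trans (ler_normD _ _) _; rewrite [ltRHS]splitr ltrD.
  exists (limn (fun n => sf_int a b (r n))); split.
    exists s; apply: ae_imp cs => t h /abT; exact: h.
  exists r; split => //; under eq_fun do rewrite intE.
  by apply: cvg_EFin; [exact: nearW|exact: segint_r].
have [_ [q [q0 qv]]] : is_bochner_integral a b g (bochner_int a b g).
  by have [v hv] := bochner_ex; exact: xgetI hv.
have {}q0 : segint a b (fun t => `|u t - sf_eval (q n) t|) @[n --> \oo] --> (0 : R).
  by move: q0; under eq_fun do rewrite intE; move=> /fine_cvgP[].
have h1 : ip (sf_int a b (q n)) e @[n --> \oo] --> ip (bochner_int a b g) e.
  exact: (cvg_ipl Hip).
apply: (cvg_unique _ h1) => //.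
apply/cvgrPdist_le => d d0.
have e1 : 0 < `|e| + 1 by rewrite ltr_wpDl.
move/cvgrPdist_le : q0 => /(_ (d / (`|e| + 1))); rewrite divr_gt0// => /(_ isT).
apply: filterS => n; rewrite sub0r normrN ger0_norm ?segint_ge0// => hn.
have mq := strong_borel_sf (q n).
have bq : norm_bounded (sf_eval (q n)) := sf_bounded _.
rewrite ip_sf_int -segintB; [|exact: (bounded_borel_ip_cst Hip)..].
rewrite (_ : (fun t => _ - _) = fun t => ip (u t - sf_eval (q n) t) e); last first.
  by apply/funext => t; rewrite ipBl.
apply: le_trans (segint_ip_le Hip _ _ _ _ _) _;
  [exact: strong_borelB|exact: norm_boundedB|].
apply: (@le_trans _ _ ((`|e| + 1) * (d / (`|e| + 1)))).
  by apply: ler_pM => //; [exact: segint_ge0|rewrite lerDl].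
by rewrite mulrC divfK// gt_eqF.
Qed.

End BochnerIntegral.

(** * The grid and piecewise defined functions *)

Section Grid.
Context {R : realType} {H : normedModType R} (T : R) (n : nat).
Hypotheses (T_gt0 : 0 < T) (n_gt0 : (0 < n)%N).
Implicit Types (k j : nat) (t : R) (w : nat -> R -> H).

Lemma grid_size_gt0 : 0 < n%:R :> R. Proof. by rewrite ltr0n. Qed.

Lemma step_gt0 : 0 < T / n%:R. Proof. by rewrite divr_gt0// grid_size_gt0. Qed.

Lemma grid0 : grid T n 0 = 0. Proof. by rewrite /grid !mul0r. Qed.

Lemma gridn : grid T n n = T.
Proof. by rewrite /grid mulrAC divff ?mul1r// gt_eqF// grid_size_gt0. Qed.

Lemma gridS k : grid T n k.+1 = grid T n k + T / n%:R.
Proof. by rewrite /grid -natr1 mulrDl mul1r mulrDl. Qed.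

Lemma grid_le k j : (grid T n k <= grid T n j) = (k <= j)%N.
Proof.
by rewrite /grid ler_pM2r ?invr_gt0 ?grid_size_gt0// ler_pM2r// ler_nat.
Qed.

Lemma grid_ge0 k : 0 <= grid T n k.
Proof. by rewrite -grid0 grid_le. Qed.

Lemma grid_leT k : (k <= n)%N -> grid T n k <= T.
Proof. by rewrite -[X in _ <= X]gridn grid_le. Qed.

Lemma cell_exists t : 0 < t <= T ->
  exists2 k, (k < n)%N & grid T n k < t <= grid T n k.+1.
Proof.
move=> /andP[t0 tT].
have ex : exists k, t <= grid T n k by exists n; rewrite gridn.
case: (ex_minnP ex) => -[|k] tk kmin; first by move: tk; rewrite grid0 leNgt t0.
exists k; first by apply: kmin; rewrite gridn.
by rewrite tk andbT ltNge; apply/negP => /kmin; rewrite ltnn.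
Qed.

Lemma cell_unique k j t : grid T n k < t <= grid T n k.+1 ->
  grid T n j < t <= grid T n j.+1 -> k = j.
Proof.
move=> /andP[k1 k2] /andP[j1 j2]; apply/eqP; rewrite eqn_leq.
have := lt_le_trans k1 j2; have := lt_le_trans j1 k2.
by rewrite !ltNge !grid_le -!ltnNge !ltnS => -> ->.
Qed.

Definition cell_glue w t : H :=
  \sum_(k < n) \1_(`]grid T n k, grid T n k.+1] : set R) t *: w k t.

Lemma cell_glueE w k t : (k < n)%N -> grid T n k < t <= grid T n k.+1 ->
  cell_glue w t = w k t.
Proof.
move=> kn kt; rewrite /cell_glue (bigD1 (Ordinal kn))//= big1 ?addr0.
  by rewrite indicE mem_set ?scale1r//= in_itv.
move=> j jk; rewrite indicE memNset ?scale0r//= in_itv/= => /(cell_unique kt) kj.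
by move/eqP : jk; apply; apply/val_inj; rewrite /= -kj.
Qed.

Lemma cell_glue_out w t : ~~ (0 < t <= T) -> cell_glue w t = 0.
Proof.
move=> tT; rewrite /cell_glue big1// => j _.
rewrite indicE memNset ?scale0r//= in_itv/= => /andP[jt tj].
move/negP : tT; apply; rewrite (le_lt_trans (grid_ge0 j) jt)/=.
exact: le_trans tj (grid_leT (ltn_ord j)).
Qed.

Lemma cell_glue_bound w M : 0 <= M ->
  (forall k t, (k < n)%N -> `|w k t| <= M) -> forall t, `|cell_glue w t| <= M.
Proof.
move=> M0 wM t; have [tT|tT] := boolP (0 < t <= T); last first.
  by rewrite cell_glue_out// normr0.
by have [k kn kt] := cell_exists tT; rewrite (cell_glueE _ kn kt); exact: wM.
Qed.

Lemma strong_borel_cell_glue w : (forall k, strong_borel (w k)) ->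
  strong_borel (cell_glue w).
Proof.
move=> mw; apply: (@strong_borel_sum _ _ n (fun k t =>
  \1_(`]grid T n k, grid T n k.+1] : set R) t *: w k t)) => k.
by apply: strong_borel_indic => //; exact: measurable_itv.
Qed.

End Grid.

(** * Distance to a set *)

Lemma dist_set_le (R : realType) (H : normedModType R) (S : set H) (x z : H) :
  S z -> dist_set S x <= `|x - z|.
Proof.
by move=> Sz; apply: ge_inf; [exists 0 => _ [? _ <-]|exists z].
Qed.

Lemma dist_set_ge0 (R : realType) (H : normedModType R) (S : set H) (x : H) :
  0 <= dist_set S x.
Proof.
have [->|/set0P[z Sz]] := eqVneq S set0.
  by rewrite /dist_set image_set0 inf0.
by apply: lb_le_inf; [exists `|x - z|, z|move=> _ [? _ <-]].
Qed.

Lemma le_sqrtD (R : realType) (x d e : R) : 0 <= x -> 0 <= d -> 0 <= e ->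
  x ^+ 2 < d ^+ 2 + e -> x <= d + Num.sqrt e.
Proof.
move=> x0 d0 e0 xd; rewrite leNgt; apply/negP => dx.
have s0 := sqrtr_ge0 e.
have : (d + Num.sqrt e) ^+ 2 < x ^+ 2 by rewrite ltr_pXn2r// nnegrE addr_ge0.
by move=> h; have := lt_trans h xd; rewrite sqrrD sqr_sqrtr//; nra.
Qed.

(** * Estimates on one run of the scheme *)

Section OneScheme.
Context {R : realType} {H : completeNormedModType R} (ip : {dot H for idfun}).
Hypothesis Hip : induces_norm ip.
Local Notation mu := (@lebesgue_measure R).
Variables (T : R) (C Ceta : set H) (x0 : H) (f : R -> H -> H) (h : H -> R)
  (gam L eps eta : R) (n : nat) (y : nat -> H) (x : R -> H).
Hypotheses (T_gt0 : 0 < T) (Cx0 : C x0) (h_ge0 : forall z, 0 <= h z)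
  (L_ge0 : 0 <= L) (h_lip : forall z z', h z <= h z' + L * `|z - z'|)
  (gam_ge0 : 0 <= gam) (eps_gt0 : 0 < eps) (eta_gt0 : 0 < eta)
  (n_gt0 : (0 < n)%N) (enl : enlargement C eta Ceta)
  (f_meas : forall z, strongly_measurable 0 T (f^~ z))
  (f_bound : forall z, {ae mu, forall t, 0 <= t <= T -> `|f t z| <= h z + gam})
  (scheme : catching_up T C Ceta f x0 eps n y x).
Let tk := grid T n.
Let m := T / n%:R.
Let I k := bochner_int (tk k) (tk k.+1) (f^~ (y k)).
Let err := (eta + Num.sqrt eps) / m.

Lemma selection_borel_version : exists u : nat -> R -> H, forall k,
  [/\ strong_borel (u k), forall t, `|u k t| <= h (y k) + gam,
    {ae mu, forall t, 0 <= t <= T -> u k t = f t (y k)} &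
    forall a b e, 0 <= a -> a <= b -> b <= T ->
      ip (bochner_int a b (f^~ (y k))) e = segint a b (fun t => ip (u k t) e)].
Proof.
have rep k : exists u : R -> H, [/\ strong_borel u, forall t, `|u t| <= h (y k) + gam,
    {ae mu, forall t, 0 <= t <= T -> u t = f t (y k)} &
    forall a b e, 0 <= a -> a <= b -> b <= T ->
      ip (bochner_int a b (f^~ (y k))) e = segint a b (fun t => ip (u t) e)].
  have [u [h1 h2 h3 h4]] := bochner_representation Hip (f_meas (y k)) (f_bound (y k)).
  by exists u; split => // t; rewrite (le_trans (h2 t))// ger0_norm// addr_ge0.
by have [u hu] := choice rep; exists u.
Qed.

Let m_gt0 : 0 < m. Proof. exact: step_gt0. Qed.

Lemma field_integral_bound k : (k < n)%N -> `|I k| <= m * (h (y k) + gam).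
Proof.
move=> kn; have [u /(_ k)[mu_ bu _ rep]] := selection_borel_version.
have tkk : tk k <= tk k.+1 by rewrite grid_le.
rewrite mulrC (_ : m = tk k.+1 - tk k); last by rewrite /tk gridS addrAC subrr add0r.
apply: (norm_le_segint_cst Hip tkk mu_ bu) => e.
by apply: rep => //; [exact: grid_ge0|exact: grid_leT].
Qed.

Lemma near_C k : (k <= n)%N -> exists2 c, C c & `|y k - c| <= eta.
Proof.
have [y0 yS _ _] := scheme; case: k => [|k] kn.
  by exists x0 => //; rewrite y0 subrr normr0 ltW.
have [yC _] := yS k kn; have [_ _ /(_ _ yC)[c Cc [b bB <-]]] := enl.
by exists c => //; rewrite addrAC subrr add0r.
Qed.

(** The vector of which an approximate normal direction is made: the correction
of the projection step, per unit of time. *)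
Definition defect k : H := m^-1 *: (y k + I k - y k.+1).

(** The node [y k] is within [eta] of [C], so the distance from the predictor
[y k + I k] to [C] is at most [|I k| + eta]. *)
Lemma defect_bound k : (k < n)%N -> `|defect k| <= h (y k) + gam + err.
Proof.
move=> kn; have [_ /(_ k kn)[_ yS] _ _] := scheme.
have [c Cc yc] := near_C (ltnW kn).
have d1 : dist_set C (y k + I k) <= m * (h (y k) + gam) + eta.
  apply: le_trans (dist_set_le _ Cc) _; rewrite addrAC addrC.
  by apply: le_trans (ler_normD _ _) _; apply: lerD => //;
    exact: field_integral_bound.
have := le_sqrtD (normr_ge0 _) (dist_set_ge0 _ _) (ltW eps_gt0) yS.
rewrite -/(I k) => d2.
rewrite /defect normrZ ger0_norm ?invr_ge0 ?(ltW m_gt0)// mulrC ler_pdivrMr//.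
rewrite mulrDl /err divfK ?gt_eqF// mulrC addrA.
by apply: le_trans d2 _; rewrite lerD2r.
Qed.

Lemma step_decomp k : y k.+1 - y k = I k - m *: defect k.
Proof.
rewrite /defect scalerA divff ?gt_eqF// scale1r (addrC (y k)) -addrA opprD.
by rewrite addrA subrr add0r opprB.
Qed.

Variable B : R.
Hypothesis err_le : err <= B.

(** Gronwall bound on the distance from the nodes to [x0]. *)
Definition radius := T * (2 * (h x0 + gam) + B) * expR (2 * L * T).
(** A bound on both parts of the velocity that depends on the run only through
the bound [B] on its errors. *)
Definition speed := h x0 + L * radius + gam + B.

Let err_ge0 : 0 <= err.
Proof. by rewrite divr_ge0 ?addr_ge0 ?sqrtr_ge0 ?ltW. Qed.

Let B_ge0 : 0 <= B. Proof. exact: le_trans err_le. Qed.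

Let K := 2 * (h x0 + gam) + B.
Let K_ge0 : 0 <= K. Proof. by rewrite !addr_ge0// mulr_ge0// addr_ge0. Qed.

(** The distances [a k] from the nodes to [x0] satisfy
[a k.+1 <= (1 + 2 m L) a k + m K], and [1 + 2 m L <= exp (2 m L)]. *)
Lemma nodes_bounded k : (k <= n)%N -> `|y k - x0| <= radius.
Proof.
have [y0 _ _ _] := scheme.
pose E := expR (2 * m * L).
have E_ge : 1 + 2 * m * L <= E by exact: expR_ge1Dx.
have mL : 0 <= 2 * m * L by rewrite !mulr_ge0// ltW.
have E1 : 1 <= E by apply: le_trans E_ge; rewrite lerDl.
have E0 : 0 <= E by exact: le_trans E1.
have rec j : (j <= n)%N -> `|y j - x0| <= j%:R * m * K * E ^+ j.
  elim: j => [_|j IH jn]; first by rewrite y0 subrr normr0 !mul0r.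
  have {}IH := IH (ltnW jn).
  have step : `|y j.+1 - x0| <= `|y j - x0| * (1 + 2 * m * L) + m * K.
    rewrite -(subrK (y j) (y j.+1)) -addrA step_decomp.
    apply: le_trans (ler_normD _ _) _;
      apply: le_trans (lerD (ler_normB _ _) (lexx _)) _.
    have := field_integral_bound jn; have := defect_bound jn.
    have := h_lip (y j) x0.
    rewrite (normrZ m (defect j)) (ger0_norm (ltW m_gt0)) => h1 h2 h3.
    have h4 : m * `|defect j| <= m * (h (y j) + gam + B).
      by rewrite ler_pM2l//; apply: le_trans h2 _; rewrite lerD2l.
    have h5 : m * h (y j) <= m * (h x0 + L * `|y j - x0|) by rewrite ler_pM2l.
    rewrite /K; nra.
  apply: le_trans step _.
  have Ej : 1 <= E ^+ j.+1 by exact: exprn_ege1.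
  apply: (@le_trans _ _ (j%:R * m * K * E ^+ j * E + m * K * E ^+ j.+1)).
    apply: lerD; last by rewrite ler_peMr// mulr_ge0// ltW.
    by apply: ler_pM => //; rewrite addr_ge0.
  by rewrite -mulrA -exprSr -mulrDl -[in leRHS]natr1 !mulrDl mul1r.
move=> kn; apply: le_trans (rec k kn) _; rewrite /radius -/K.
have km : k%:R * m <= T.
  by rewrite /m mulrA; exact: (grid_leT T_gt0 n_gt0 kn).
apply: ler_pM.
- by rewrite !mulr_ge0// ltW.
- exact: exprn_ge0.
- by rewrite ler_wpM2r.
- rewrite /E -expRM_natr ler_expR.
  have -> : 2 * m * L * k%:R = 2 * L * (k%:R * m) by ring.
  by rewrite ler_wpM2l// mulr_ge0.
Qed.

Lemma h_nodes k : (k <= n)%N -> h (y k) + gam + B <= speed.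
Proof.
move=> kn; rewrite /speed 2!lerD2r; apply: le_trans (h_lip _ x0) _.
by rewrite lerD2l ler_wpM2l// nodes_bounded.
Qed.

Lemma speed_ge0 : 0 <= speed.
Proof. by apply: le_trans (h_nodes (leq0n n)); rewrite !addr_ge0. Qed.


(** What remains of the choice of [q] as an approximate projection of [v + q]
once the enlarged set is forgotten: [q] is close to some [c] in [C], and no
point of [C] is nearer to [v + q] than [q] is, up to [eps]. *)
Definition almost_projection (v q : H) := exists2 c, C c & `|q - c| <= eta /\
  forall c', C c' -> `|v| ^+ 2 <= `|v + q - c'| ^+ 2 + eps.

Lemma defect_almost_projection k : (k < n)%N ->
  almost_projection (m *: defect k) (y k.+1).
Proof.
move=> kn; have [c Cc yc] := near_C kn; exists c => //; split => // c' Cc'.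
have [_ /(_ k kn)[_ yS] _ _] := scheme.
rewrite /defect scalerA divff ?gt_eqF// scale1r subrK.
apply: le_trans (ltW yS) _; rewrite lerD2r ler_pXn2r ?nnegrE ?dist_set_ge0//.
exact: dist_set_le.
Qed.

Lemma scheme_at_node k : (k <= n)%N -> x (tk k) = y k.
Proof.
have [y0 _ xx0 xE] := scheme; case: k => [_|k kn].
  by rewrite /tk grid0 xx0 y0.
have tkk : tk k < tk k.+1 by rewrite /tk gridS ltrDl.
rewrite (xE k)// -/tk ?tkk ?lexx// -/(I k).
have -> : tk k.+1 - tk k = T / n%:R by rewrite /tk gridS addrAC subrr add0r.
rewrite divff ?scale1r ?gt_eqF// -addrA subrK addrC subrK //.
Qed.

(** The run is the primitive of [V - W]. In the last clause, [z] and [q] are the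
nodes at the beginning and at the end of the current cell; it only holds almost
everywhere because [V] glues Borel versions of the maps [f^~ (y k)]. *)
Lemma scheme_velocity : exists W V : R -> H,
  [/\ strong_borel W, strong_borel V, (forall t, `|W t| <= speed),
    (forall t, `|V t| <= speed) &
    (forall t e, 0 <= t <= T ->
      ip (x t - x0) e = segint 0 t (fun s => ip (V s - W s) e))] /\
  [/\ (forall s t, 0 <= s -> s <= t -> t <= T ->
        `|x t - x s| <= 2 * speed * (t - s)),
      (forall t, 0 <= t <= T ->
        exists2 c, C c & `|x t - c| <= 2 * speed * m + eta) &
  {ae mu, forall t, 0 < t <= T -> exists z q,
    [/\ `|x t - z| <= 2 * speed * m, `|x t - q| <= 2 * speed * m,
        V t = f t z /\ `|V t| <= h z + gam, `|W t| <= h z + gam + err &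
        almost_projection (m *: W t) q]}].
Proof.
have [u hu] := selection_borel_version.
pose W := cell_glue T n (fun k _ => defect k).
pose V := cell_glue T n u.
have WE k t : (k < n)%N -> tk k < t <= tk k.+1 -> W t = defect k.
  by move=> kn kt; rewrite /W (cell_glueE T_gt0 n_gt0 _ kn kt).
have VE k t : (k < n)%N -> tk k < t <= tk k.+1 -> V t = u k t.
  by move=> kn kt; rewrite /V (cell_glueE T_gt0 n_gt0 _ kn kt).
have mW : strong_borel W by apply: strong_borel_cell_glue => k;
  exact: strong_borel_cst.
have mV : strong_borel V by apply: strong_borel_cell_glue => k; have [] := hu k.
have bW t : `|W t| <= speed.
  apply: (cell_glue_bound T_gt0 n_gt0 speed_ge0) => k s kn.
  apply: le_trans (defect_bound kn) _; apply: le_trans (h_nodes (ltnW kn)).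
  by rewrite lerD2l.
have bV t : `|V t| <= speed.
  apply: (cell_glue_bound T_gt0 n_gt0 speed_ge0) => k s kn.
  have [_ /(_ s) us _ _] := hu k; apply: le_trans us _.
  by apply: le_trans (h_nodes (ltnW kn)); rewrite lerDl.
have vbW : norm_bounded W by exists speed.
have vbV : norm_bounded V by exists speed.
have mVW : strong_borel (fun t => V t - W t) by exact: strong_borelB.
have vbVW : norm_bounded (fun t => V t - W t) by exact: norm_boundedB.
(* one cell: the affine part of the interpolation integrates the constant [- W] *)
have cell k t e : (k < n)%N -> tk k < t <= tk k.+1 ->
    ip (x t - y k) e = segint (tk k) t (fun s => ip (V s - W s) e).
  move=> kn /andP[kt tk1].
  have [_ _ _ xE] := scheme; rewrite (xE k t kn) ?kt//.
  have [mu_ bu _ rep] := hu k.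
  rewrite addrAC (addrC (y k)) addrK ipDl ipZl rep; last 3 first.
  - exact: grid_ge0.
  - exact: ltW.
  - exact: le_trans tk1 (grid_leT _ _ _).
  have vbu : norm_bounded (u k) by exists (h (y k) + gam).
  rewrite [RHS](@segint_eq _ _ _ _ (fun s => ip (u k s) e - ip (defect k) e));
    last 3 first.
  - move=> s /andP[ks st]; have hs : tk k < s <= tk k.+1 by rewrite ks (le_trans st).
    by rewrite ipBl (WE k)// (VE k).
  - exact: (bounded_borel_ip_cst Hip).
  - apply: bounded_borelB; first exact: (bounded_borel_ip_cst Hip).
    exact: bounded_borel_cst.
  rewrite segintB; [|exact: (bounded_borel_ip_cst Hip)|exact: bounded_borel_cst].
  rewrite segint_cst; last exact: ltW.
  rewrite addrC; congr (_ + _).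
  have -> : y k.+1 - y k - I k = - (m *: defect k).
    by rewrite step_decomp addrAC subrr add0r.
  by rewrite ipNl ipZl -/m -/tk mulrN mulrA divfK ?gt_eqF// mulrC.
have ident k : (k <= n)%N -> forall t e, 0 <= t <= tk k ->
    ip (x t - x0) e = segint 0 t (fun s => ip (V s - W s) e).
  elim: k => [_|k IH kn] t e.
    rewrite /tk grid0 => /le_anti <-; have [_ _ -> _] := scheme.
    by rewrite subrr ip0l segint_same.
  move=> /andP[t0 t1]; have [tk0|tk0] := leP t (tk k).
    by apply: IH; [exact: ltnW|rewrite t0].
  rewrite -(subrK (y k) (x t)) -addrA ipDl (cell k)// ?tk0//.
  rewrite -scheme_at_node; last exact: ltnW.
  rewrite IH; [|exact: ltnW|by rewrite lexx andbT grid_ge0].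
  rewrite addrC -segint_split//; [exact: grid_ge0|exact: ltW|].
  exact: (bounded_borel_ip_cst Hip).
have identT t e : 0 <= t <= T ->
    ip (x t - x0) e = segint 0 t (fun s => ip (V s - W s) e).
  by move=> tT; apply: (ident n) => //; rewrite /tk gridn.
exists W, V; split; first by split.
have speedB t : `|V t - W t| <= 2 * speed.
  by apply: le_trans (ler_normB _ _) _; rewrite mulr_natl mulr2n lerD.
have vlip s t : 0 <= s -> s <= t -> t <= T -> `|x t - x s| <= 2 * speed * (t - s).
  move=> s0 st tT; apply: (norm_le_segint_cst Hip st mVW speedB) => e.
  have -> : x t - x s = (x t - x0) - (x s - x0).
    by rewrite opprB addrA subrK.
  rewrite ipBl !identT ?s0 ?tT ?(le_trans s0)// ?(le_trans st)//.
  by rewrite (segint_split s0 st) ?addrK 1?addrC ?addKr//;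
    exact: (bounded_borel_ip_cst Hip).
have speed2 : 0 <= 2 * speed by rewrite mulr_ge0// speed_ge0.
have cell_dist k t : (k < n)%N -> tk k < t <= tk k.+1 ->
    `|x t - y k| <= 2 * speed * m /\ `|x t - y k.+1| <= 2 * speed * m.
  move=> kn /andP[kt1 kt2].
  have t1 : tk k.+1 <= T by exact: grid_leT.
  have k0 : 0 <= tk k by exact: grid_ge0.
  split.
  - rewrite -(scheme_at_node (ltnW kn)).
    apply: le_trans (vlip _ _ k0 (ltW kt1) (le_trans kt2 t1)) _.
    by rewrite ler_wpM2l// lerBlDl -gridS.
  - rewrite -(scheme_at_node kn) distrC.
    apply: le_trans (vlip _ _ (ltW (le_lt_trans k0 kt1)) kt2 t1) _.
    by rewrite ler_wpM2l// /tk gridS lerBlDl lerD2r ltW.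
split => //.
  move=> t /andP[]; rewrite le_eqVlt => /predU1P[<- _|t0 tT].
    exists x0 => //; have [_ _ -> _] := scheme; rewrite subrr normr0.
    by apply: addr_ge0; [apply: mulr_ge0|]; rewrite // ltW.
  have [|k kn kt] := @cell_exists R T n n_gt0 t; first by rewrite t0.
  have [c Cc yc] := near_C kn; exists c => //.
  apply: le_trans (ler_distD (y k.+1) _ _) _; apply: lerD => //.
  exact: (cell_dist k t kn kt).2.
have aeu := ae_all_nat (fun k => let: And4 _ _ h3 _ := hu k in h3).
apply: ae_imp aeu => t hut tT.
have [k kn kt] := cell_exists n_gt0 tT; have [t0 t1] := andP tT.
exists (y k), (y k.+1); split.
- exact: (cell_dist k t kn kt).1.
- exact: (cell_dist k t kn kt).2.
- rewrite (VE k)//; split; first by apply: hut; rewrite ltW.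
  by have [_ ->] := hu k.
- by rewrite (WE k)//; exact: defect_bound.
- by rewrite (WE k)//; exact: defect_almost_projection.
Qed.

End OneScheme.

(** * Uniform convergence of a subsequence *)

Section Compactness.
Context {R : realType} {H : normedModType R}.

Lemma ball_compact_closed (C : set H) : ball_compact C -> closed C.
Proof.
move=> Cc z zC; have r0 : 0 < `|z| + 1 by rewrite ltr_wpDl.
have cl : closed (C `&` cball (`|z| + 1)).
  by apply: (compact_closed (@norm_hausdorff _ _)); exact: Cc.
suff [] : (C `&` cball (`|z| + 1)) z by [].
apply: cl => B Bz; have [|w [Cw [Bw wz]]] := zC (B `&` ball z 1).
  by apply: filterI => //; exact: nbhsx_ballx.
exists w; split => //; split => //; rewrite /cball/=.
move: wz; rewrite -ball_normE/= distrC => wz.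
rewrite -(subrK z w); apply: le_trans (ler_normD _ _) _.
by rewrite addrC lerD2l ltW.
Qed.

Lemma near_coordinate (x : prod_topology (fun _ : R => H)) (t e : R) :
  0 < e -> nbhs x [set g : prod_topology (fun _ : R => H) | `|g t - x t| < e].
Proof.
move=> e0.
have h : nbhs (proj t x) (ball (x t) e) by exact: (nbhsx_ballx (x t) e e0).
have hp := @proj_continuous R (fun=> H) t x _ h.
rewrite (_ : mkset _ = proj t @^-1` ball (x t) e); first exact: hp.
by apply/seteqP; split => g /=; rewrite /proj -ball_normE /= distrC.
Qed.

(** The maps [X i] are close to maps [c i] with values in a compact part of [C].
Being in a product of compact sets, the sequence [c] has a cluster point [x] for
pointwise convergence. Closeness on a fine grid is a neighbourhood condition,
and it becomes uniform closeness because the [X i], hence also [x], are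
[K]-Lipschitz. *)
Lemma uniform_subsequence (T K b : R) (C : set H) (X : nat -> R -> H)
    (rho : nat -> R) :
  0 < T -> 0 <= K -> 0 <= b -> ball_compact C ->
  (forall i (s t : R), 0 <= s -> s <= t -> t <= T ->
    `|X i t - X i s| <= K * (t - s)) ->
  (forall i (t : R), 0 <= t <= T -> `|X i t| <= b) ->
  (forall i (t : R), 0 <= t <= T -> exists2 c, C c & `|X i t - c| <= rho i) ->
  rho @ \oo --> (0 : R) ->
  exists (phi : nat -> nat) (x : R -> H),
    [/\ {homo phi : i j / (i < j)%N}, (forall t : R, 0 <= t <= T -> C (x t)) &
     forall i (t : R), 0 <= t <= T -> `|X (phi i) t - x t| <= harmonic i].
Proof.
move=> T0 K0 b0 Cc Xlip Xb Xc rho0.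
have rho_small e N : 0 < e -> exists N', (N <= N')%N /\ forall i, (N' <= i)%N ->
  rho i <= e.
  move=> e0; move/cvgrPdist_lt : rho0 => /(_ e e0)[N1 _ hN1].
  exists (maxn N N1); split; first exact: leq_maxl.
  move=> i; rewrite geq_max => /andP[_ /hN1]; rewrite /= sub0r normrN => h.
  by apply: le_trans (ler_norm _) (ltW h).
have [N0 [_ hN0]] := rho_small 1 0%N ltr01.
pose K1 := C `&` cball (b + 1).
have K1c : compact K1 by apply: Cc; rewrite ltr_wpDl.
have pick i (t : R) : exists c, (0 <= t <= T -> (N0 <= i)%N ->
  `|X i t - c| <= rho i) /\ K1 c.
  have near_pt t' j : 0 <= t' <= T -> (N0 <= j)%N -> exists c,
    `|X j t' - c| <= rho j /\ K1 c.
    move=> tT ij; have [c Cc' Xc'] := Xc j t' tT; exists c; split => //; split => //.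
    rewrite /cball/= -(subrK (X j t') c); apply: le_trans (ler_normD _ _) _.
    rewrite addrC distrC lerD//; first exact: Xb.
    exact: le_trans Xc' (hN0 _ ij).
  have [tT|tT] := boolP (0 <= t <= T); last first.
    have T00 : 0 <= (0 : R) <= T by rewrite lexx ltW.
    by have [c [_ Kc]] := near_pt 0 N0 T00 (leqnn _); exists c.
  have [ij|ij] := leqP N0 i.
    by have [c [h Kc]] := near_pt t i tT ij; exists c.
  by have [c [_ Kc]] := near_pt t N0 tT (leqnn _); exists c.
have pick_fun i : exists g : R -> H,
    forall t, (0 <= t <= T -> (N0 <= i)%N -> `|X i t - g t| <= rho i) /\ K1 (g t).
  by have [g hg] := choice (pick i); exists g.
have [c hc] := choice pick_fun.
pose P := prod_topology (fun _ : R => H).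
have cA : compact [set g : P | forall t, K1 (g t)].
  exact: (@tychonoff R (fun=> H) (fun=> K1)).
have [|x [Ax clx]] := cA ((c : nat -> P) @ \oo) _.
  by exists 0%N => // i _ /= t; have [_] := hc i t.
(* infinitely many [c i] are close to [x] on any given finite family of times *)
have meet (n : nat) (s : 'I_n -> R) e N : 0 < e -> exists2 i, (N <= i)%N &
    forall k, `|c i (s k) - x (s k)| < e.
  move=> e0.
  have nb : nbhs (x : P) [set g : P | forall k, `|g (s k) - x (s k)| < e].
    exact: (@filter_forall P _ (fun k => [set g : P | `|g (s k) - x (s k)| < e])
      (nbhs (x : P)) _ (fun k => near_coordinate x (s k) e0)).
  have [|g [[i iN <-] gx]] := clx [set c i | i in [set i | (N <= i)%N]] _ _ nb.
    by exists N => // i /= iN; exists i.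
  by exists i.
have xlip s t : 0 <= s -> s <= t -> t <= T -> `|x t - x s| <= K * (t - s).
  move=> s0 st tT; apply/ler_addgt0Pr => e e0.
  have e4 : 0 < e / 4 by rewrite divr_gt0.
  have [N [N0N hN]] := rho_small _ N0 e4.
  pose p (k : 'I_2) := if val k == 0%N then s else t.
  have [i Ni hi] := meet 2 p _ N e4.
  have i0 : (N0 <= i)%N := leq_trans N0N Ni.
  have hs : 0 <= s <= T by rewrite s0 (le_trans st).
  have ht : 0 <= t <= T by rewrite tT (le_trans s0).
  have h1 := hi ord0; have h2 := hi ord_max; rewrite /p /= in h1 h2.
  have h3 := (hc i s).1 hs i0; have h4 := (hc i t).1 ht i0.
  have h5 := Xlip i s t s0 st tT; have h6 := hN i Ni.
  have a1 := ler_distD (c i t) (x t) (x s).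
  have a2 := ler_distD (X i t) (c i t) (x s).
  have a3 := ler_distD (X i s) (X i t) (x s).
  have a4 := ler_distD (c i s) (X i s) (x s).
  rewrite (distrC (x t) (c i t)) in a1; rewrite (distrC (c i t) (X i t)) in a2.
  by lra.
(* transfer closeness at the nodes of a grid of mesh [T / n] to all times *)
have key e N : 0 < e -> exists i, (N <= i)%N /\
    forall t, 0 <= t <= T -> `|X i t - x t| <= e.
  move=> e0; have e4 : 0 < e / 4 by rewrite divr_gt0.
  have [N1 [NN1 hN1]] := rho_small _ (maxn N N0) e4.
  have [n n0 hn] : exists2 n, (0 < n)%N & K * (T / n%:R) <= e / 4.
    pose z := K * T / (e / 4); have z0 : 0 <= z by rewrite divr_ge0 ?mulr_ge0// ltW.
    exists (Num.bound z) => //.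
    have zb := archi_boundP z0.
    have b0' : 0 < (Num.bound z)%:R :> R by exact: le_lt_trans z0 zb.
    by rewrite mulrA ler_pdivrMr// -ler_pdivrMl// mulrC ltW.
  have [i Ni hi] := meet n.+1 (fun k => grid T n k) _ N1 e4.
  move: NN1; rewrite geq_max => /andP[NN1 N0N1].
  exists i; split; first exact: leq_trans NN1 Ni.
  have i0 : (N0 <= i)%N := leq_trans N0N1 Ni.
  move=> t /andP[t0 tT].
  have [k kn /andP[tk kt]] : exists2 k, (k <= n)%N & t <= grid T n k <= t + T / n%:R.
    move: t0; rewrite le_eqVlt => /predU1P[<-|t0].
      by exists 0%N => //; rewrite grid0 lexx add0r ltW// step_gt0.
    have [|k kn /andP[kt tk]] := @cell_exists R T n n0 t; first by rewrite t0.
    by exists k.+1 => //; rewrite tk/= gridS lerD2r ltW.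
  have sT : grid T n k <= T by exact: grid_leT.
  have hs : 0 <= grid T n k <= T by rewrite sT grid_ge0.
  have h1 := hi (Ordinal (kn : (k < n.+1)%N)); rewrite /= in h1.
  have h3 := (hc i _).1 hs i0; have h6 := hN1 i Ni.
  have h4 := Xlip i _ _ t0 tk sT.
  have h5 := xlip _ _ t0 tk sT.
  have h7 : K * (grid T n k - t) <= e / 4.
    by apply: le_trans hn; rewrite ler_wpM2l// lerBlDl.
  have a1 := ler_distD (X i (grid T n k)) (X i t) (x t).
  have a2 := ler_distD (c i (grid T n k)) (X i (grid T n k)) (x t).
  have a3 := ler_distD (x (grid T n k)) (c i (grid T n k)) (x t).
  rewrite (distrC (X i t) (X i _)) in a1.
  by lra.
have step N k := key (harmonic k) N (harmonic_gt0 k).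
have step_fun N : exists p : nat -> nat, forall k, (N <= p k)%N /\
    forall t : R, 0 <= t <= T -> `|X (p k) t - x t| <= harmonic k.
  by have [p hp] := choice (step N); exists p.
have [psi hpsi] := choice step_fun.
pose fix phi k := if k is k'.+1 then psi (phi k').+1 k else psi 0%N 0%N.
exists phi, x; split.
- by apply: homo_ltn => [? ? ?|i]; [exact: ltn_trans|exact: (hpsi _ _).1].
- by move=> t _; exact: (Ax t).1.
- by case=> [|i] /=; exact: (hpsi _ _).2.
Qed.
End Compactness.

(** * Convergence of midpoints of tails *)

Section TailHull.
Context {V : Type} (mid : V -> V -> V) (z : nat -> V).

(** Dyadic convex combinations of the [z i] with [m <= i]. Midpoints suffice for
the parallelogram argument, and properties of the [z i] that are preserved by
midpoints extend by induction, without finite families of weights. *)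
Inductive tail_hull (m : nat) : V -> Prop :=
| tail_hull_gen i : (m <= i)%N -> tail_hull m (z i)
| tail_hull_mid u v : tail_hull m u -> tail_hull m v -> tail_hull m (mid u v).

Lemma tail_hull_le m p u : (m <= p)%N -> tail_hull p u -> tail_hull m u.
Proof.
move=> mp; elim=> [i pi|v w _ hv _ hw].
  by apply: tail_hull_gen; exact: leq_trans pi.
exact: tail_hull_mid.
Qed.

End TailHull.

Definition midpoint (R : realType) (H : normedModType R) (u v : H) : H :=
  2^-1 *: (u + v).

Section Convergence.
Context {R : realType}.
Local Notation mu := (@lebesgue_measure R).

(** The series of the [k m] has a finite integral, so its sum is finite almost
everywhere and bounds each term. *)
Lemma ae_bounded_of_summable (a b : R) (k : nat -> R -> R) :
  (forall m, bounded_borel (k m)) -> (forall m t, 0 <= k m t) ->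
  (forall m, segint a b (k m) <= 2^-1 ^+ m) ->
  {ae mu, forall t, a <= t <= b -> exists B, forall m, k m t <= B}.
Proof.
move=> bk k0 hk.
pose S t := (\sum_(0 <= m <oo) (k m t)%:E)%E.
have mk m : measurable_fun `[a, b] (fun t => (k m t)%:E).
  by apply/measurable_EFinP; apply: measurable_funTS; exact: (bk m).1.
have mS : measurable_fun `[a, b] S.
  by apply: ge0_emeasurable_sum => // m t _ _; rewrite lee_fin.
have S0 t : (0 <= S t)%E by apply: nneseries_ge0 => m _ _; rewrite lee_fin.
have intS : mu.-integrable `[a, b] S.
  apply/integrableP; split => //.
  under eq_integral do rewrite gee0_abs//.
  rewrite integral_nneseries//; last by move=> m t _; rewrite lee_fin.
  apply: (@le_lt_trans _ _ (\sum_(0 <= m <oo) ((2^-1 ^+ m)%:E : \bar R))%E).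
    apply: lee_nneseries => [m _ _|m _]; first by apply: integral_ge0 => t _;
      rewrite lee_fin.
    by rewrite segint_EFin// lee_fin.
  rewrite (_ : limn _ = (2%:E)%E) ?ltry//.
  apply/cvg_lim => //; apply: cvg_EFin; first by apply: nearW => n; rewrite sumEFin.
  have -> : fine \o (fun n => \sum_(0 <= m < n) ((2^-1 ^+ m)%:E : \bar R))%E =
      series (geometric 1 (2^-1 : R)).
    by apply/funext => n /=; rewrite sumEFin /series /=; apply: eq_bigr => i _;
      rewrite mul1r.
  have half1 : `|2^-1| < 1 :> R by rewrite ger0_norm ?invr_ge0// invf_lt1// ltr1n.
  have := @cvg_geometric_series R 1 2^-1 half1.
  by rewrite (_ : 1 * (1 - 2^-1)^-1 = 2 :> R)//; field.
have /= := @integrable_ae _ _ _ mu `[a, b] _ S intS; move=> /(_ ltac:(by [])).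
apply: ae_imp => t h tab.
have {}h : S t \is a fin_num by apply: h; rewrite /= in_itv.
exists (fine (S t)) => m; rewrite -lee_fin fineK//.
apply: le_trans (nneseries_lim_ge m.+1 _); last by move=> i _ _; rewrite lee_fin.
rewrite big_nat_recr//= leeDr// sumEFin lee_fin; exact: sumr_ge0.
Qed.

Lemma geometric_cvg (H : completeNormedModType R) (u : nat -> H) (B : R) :
  (forall m, `|u m.+1 - u m| <= B * 2^-1 ^+ m) -> cvgn u.
Proof.
move=> hu.
have B0 : 0 <= B by have := hu 0%N; rewrite expr0 mulr1; apply: le_trans.
have far m k : `|u (m + k)%N - u m| <= B * 2^-1 ^+ m * (2 - 2 * 2^-1 ^+ k).
  elim: k => [|k IH]; first by rewrite addn0 subrr normr0 expr0 mulr1 subrr mulr0.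
  apply: le_trans (ler_distD (u (m + k)%N) _ _) _.
  rewrite addnS; apply: le_trans (lerD (hu _) IH) _.
  by rewrite exprD exprS le_eqVlt; apply/orP; left; apply/eqP; field.
apply/cauchy_cvgP/cauchyP => e e0.
have g0 : (fun m => 2 * B * 2^-1 ^+ m) @ \oo --> (0 : R).
  rewrite -[X in _ --> X](mulr0 (2 * B)); apply: cvgMr.
  by apply: cvg_expr; rewrite ger0_norm ?invr_ge0// invf_lt1// ltr1n.
move/cvgrPdist_lt : g0 => /(_ e e0)[N _ /(_ N (leqnn _))]; rewrite sub0r normrN => hN.
exists (u N); change (\forall p \near \oo, ball (u N) e (u p)).
exists N => // p /= Np; rewrite -ball_normE /= distrC -(subnKC Np).
apply: le_lt_trans (far _ _) _; apply: le_lt_trans hN.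
apply: le_trans (ler_norm _).
have h1 : 0 <= 2^-1 ^+ N :> R by rewrite exprn_ge0.
have h2 : 0 <= 2^-1 ^+ (p - N) :> R by rewrite exprn_ge0.
have h3 : 0 <= B * 2^-1 ^+ N by rewrite mulr_ge0.
by nra.
Qed.

End Convergence.

Section Trajectories.
Context {R : realType} {H : completeNormedModType R} (ip : {dot H for idfun}).
Hypothesis Hip : induces_norm ip.
Local Notation mu := (@lebesgue_measure R).

(** The three components have to be averaged with the same weights, hence the
bundle. The velocity is [field_part - normal_part]. *)
Record trajectory := Trajectory {
  normal_part : R -> H; field_part : R -> H; position : R -> H }.

Definition mid_trajectory (u v : trajectory) := Trajectory
  (fun t => midpoint (normal_part u t) (normal_part v t))
  (fun t => midpoint (field_part u t) (field_part v t))
  (fun t => midpoint (position u t) (position v t)).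

Lemma strong_borel_midpoint (u v : R -> H) : strong_borel u -> strong_borel v ->
  strong_borel (fun t => midpoint (u t) (v t)).
Proof. by move=> mu_ mv; apply: strong_borelZ; exact: strong_borelD. Qed.

Lemma ip_midpoint (u v e : H) : ip (midpoint u v) e = (ip u e + ip v e) / 2.
Proof. by rewrite ipZl ipDl mulrC. Qed.

Lemma midpoint_dist_le (u v c : H) (M : R) : `|u - c| <= M -> `|v - c| <= M ->
  `|midpoint u v - c| <= M.
Proof.
move=> uM vM; have -> : midpoint u v - c = 2^-1 *: ((u - c) + (v - c)).
  rewrite addrACA [RHS]scalerDr; congr (_ + _).
  by rewrite -opprD scalerN -mulr2n -(scaler_nat 2 c) scalerA mulVf// scale1r.
rewrite normrZ ger0_norm ?invr_ge0// mulrC ler_pdivrMr// mulr_natr mulr2n.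
by apply: le_trans (ler_normD _ _) _; exact: lerD.
Qed.

Lemma midpoint_norm_le (u v : H) (M : R) : `|u| <= M -> `|v| <= M ->
  `|midpoint u v| <= M.
Proof.
by move=> uM vM; rewrite -[midpoint _ _]subr0; apply: midpoint_dist_le; rewrite subr0.
Qed.

Variables (T M : R).
Variable z : nat -> trajectory.
Hypotheses (T_ge0 : 0 <= T) (M_ge0 : 0 <= M).
Hypotheses (z_borel : forall i, strong_borel (normal_part (z i)) /\
  strong_borel (field_part (z i)))
  (z_bound : forall i t, `|normal_part (z i) t| <= M /\ `|field_part (z i) t| <= M).

Local Notation hull := (tail_hull mid_trajectory z).

Lemma hull_borel m u : hull m u -> strong_borel (normal_part u) /\
  strong_borel (field_part u).
Proof.
elim=> [i _|v w _ [h1 h2] _ [h3 h4]]; first exact: z_borel.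
by split; exact: strong_borel_midpoint.
Qed.

Lemma hull_bound m u t : hull m u ->
  `|normal_part u t| <= M /\ `|field_part u t| <= M.
Proof.
elim=> [i _|v w _ [h1 h2] _ [h3 h4]]; first exact: z_bound.
by split; exact: midpoint_norm_le.
Qed.

(** Almost minimal elements for the squared L2 norm [Q] of both parts of the
velocity, at the rate [8 ^ - m]: even multiplied by [4 ^ m], the squared
distances between consecutive terms are summable, which leaves pointwise
differences of order [2 ^ - m]. *)
Lemma hull_cvg_ae : exists v : nat -> trajectory, (forall m, hull m (v m)) /\
  {ae mu, forall t, 0 <= t <= T ->
    cvgn (fun m => normal_part (v m) t) /\ cvgn (fun m => field_part (v m) t)}.
Proof.
pose Q (u : trajectory) t := `|normal_part u t| ^+ 2 + `|field_part u t| ^+ 2.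
pose D (u v : trajectory) t := `|normal_part u t - normal_part v t| ^+ 2
  + `|field_part u t - field_part v t| ^+ 2.
have bsq (g : R -> H) : strong_borel g -> norm_bounded g ->
  bounded_borel (fun t => `|g t| ^+ 2).
  move=> mg bg; under eq_fun do rewrite expr2.
  by apply: bounded_borelM; exact: (bounded_borel_vnorm Hip).
have hb u : hull 0 u -> [/\ strong_borel (normal_part u),
  norm_bounded (normal_part u),
    strong_borel (field_part u) & norm_bounded (field_part u)].
  move=> hu; have [h1 h2] := hull_borel hu.
  by split => //; exists M => t; have [] := hull_bound t hu.
have bQ u : hull 0 u -> bounded_borel (Q u).
  by move=> /hb[h1 h2 h3 h4]; apply: bounded_borelD; exact: bsq.
have bD u v : hull 0 u -> hull 0 v -> bounded_borel (D u v).
  move=> /hb[h1 h2 h3 h4] /hb[k1 k2 k3 k4].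
  by apply: bounded_borelD; apply: bsq;
    (exact: strong_borelB || exact: norm_boundedB).
pose delta m : R := 2^-1 * (2^-1 ^+ m) ^+ 3.
have delta0 m : 0 < delta m by rewrite mulr_gt0 ?exprn_gt0 ?invr_gt0.
have [|||||v [hv dv _]] := @almost_minimal_sequence R trajectory mid_trajectory
    (fun u => segint 0 T (Q u)) (fun u v => segint 0 T (D u v)) hull
    ((M ^+ 2 + M ^+ 2) * (T - 0)) _ _ _ _ _ delta delta0.
- by move=> u _; apply: segint_ge0 => t; rewrite addr_ge0 ?sqr_ge0.
- move=> m; exists (z m); first exact: tail_hull_gen.
  have hz : hull 0 (z m) by exact: tail_hull_gen.
  rewrite -segint_cst//; apply: segint_le; [exact: bQ|exact: bounded_borel_cst|].
  move=> t _; have [h1 h2] := z_bound m t.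
  by apply: lerD; rewrite ler_pXn2r ?nnegrE.
- by move=> m p mp u; exact: tail_hull_le.
- by move=> m u v; exact: tail_hull_mid.
- move=> u v hu hv.
  have hm : hull 0 (mid_trajectory u v) by exact: tail_hull_mid.
  have b2 (c : R) w : hull 0 w -> bounded_borel (fun t => c * Q w t).
    by move=> hw; apply: bounded_borelM; [exact: bounded_borel_cst|exact: bQ].
  rewrite -!segintZ; [|exact: bQ..].
  rewrite -segintD -?segintB; [|by (try apply: bounded_borelD); exact: b2..].
  rewrite le_eqVlt; apply/orP; left; apply/eqP; congr segint; apply/funext => t.
  by rewrite /D /Q /= !(parallelogram Hip) /midpoint; ring.
exists v; split => //.
pose k m t := (2 ^+ m) ^+ 2 * D (v m.+1) (v m) t.
have h0 m : hull 0 (v m) by exact: tail_hull_le (hv m).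
have kb m : bounded_borel (k m) by apply: bounded_borelM;
  [exact: bounded_borel_cst|exact: bD].
have D0 u w t : 0 <= D u w t by rewrite addr_ge0 ?sqr_ge0.
have k0 m t : 0 <= k m t by rewrite mulr_ge0 ?exprn_ge0.
have kI m : segint 0 T (k m) <= 2^-1 ^+ m.
  rewrite segintZ; last exact: bD.
  apply: (@le_trans _ _ ((2 ^+ m) ^+ 2 * (delta m.+1 + delta m))).
    by rewrite ler_pM2l ?exprn_gt0.
  rewrite /delta (exprS 2^-1 m); set a := 2^-1 ^+ m.
  have -> : 2 ^+ m = a^-1 :> R by rewrite /a exprVn invrK.
  have a0 : 0 < a by rewrite exprn_gt0 ?invr_gt0.
  have -> : a^-1 ^+ 2 * (2^-1 * (2^-1 * a) ^+ 3 + 2^-1 * a ^+ 3) = 9 / 16 * a.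
    by field; rewrite gt_eqF.
  by lra.
have := ae_bounded_of_summable kb k0 kI.
apply: ae_imp => t h tT; have [B hB] := h tT.
have step (g g' : H) m : (2 ^+ m) ^+ 2 * `|g - g'| ^+ 2 <= B ->
    `|g - g'| <= Num.sqrt B * 2^-1 ^+ m.
  move=> gB; rewrite exprVn ler_pdivlMr ?exprn_gt0// mulrC.
  rewrite -(@ler_pXn2r _ 2) ?nnegrE ?mulr_ge0 ?exprn_ge0 ?sqrtr_ge0//.
  rewrite sqr_sqrtr ?exprMn//; apply: le_trans gB.
  by rewrite mulr_ge0 ?sqr_ge0.
split; apply: geometric_cvg => m; apply: step; apply: le_trans (hB m);
  rewrite /k ler_pM2l ?exprn_gt0// /D ?lerDl ?lerDr sqr_ge0//.
Qed.

End Trajectories.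

(** * The limit velocity *)

Section Limit.
Context {R : realType} {H : completeNormedModType R} (ip : {dot H for idfun}).
Hypothesis Hip : induces_norm ip.
Local Notation mu := (@lebesgue_measure R).

Variables (T M : R) (x0 : H) (x : R -> H) (z : nat -> trajectory (H := H)).
Hypotheses (T_ge0 : 0 <= T) (M_ge0 : 0 <= M).
Hypotheses (z_borel : forall i, strong_borel (normal_part (z i)) /\
  strong_borel (field_part (z i)))
  (z_bound : forall i t, `|normal_part (z i) t| <= M /\ `|field_part (z i) t| <= M)
  (z_int : forall i (t : R) e, 0 <= t <= T -> ip (position (z i) t - x0) e =
    segint 0 t (fun s => ip (field_part (z i) s - normal_part (z i) s) e))
  (z_cvg : forall i (t : R), 0 <= t <= T -> `|position (z i) t - x t| <= harmonic i).

Local Notation hull := (tail_hull mid_trajectory z).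

Lemma harmonic_le m p : (m <= p)%N -> harmonic p <= harmonic m :> R.
Proof. by move=> mp; rewrite /harmonic /= lef_pV2 ?posrE ?ltr0n// ler_nat. Qed.

Lemma hull_position m u (t : R) : 0 <= t <= T -> hull m u ->
  `|position u t - x t| <= harmonic m.
Proof.
move=> tT; elim=> [i mi|v w _ h1 _ h2]; last exact: midpoint_dist_le.
exact: le_trans (z_cvg i tT) (harmonic_le mi).
Qed.

Lemma hull_velocity m u : hull m u ->
  strong_borel (fun t => field_part u t - normal_part u t) /\
  forall t, `|field_part u t - normal_part u t| <= M + M.
Proof.
move=> hu; have [h1 h2] := hull_borel z_borel hu; split; first exact: strong_borelB.
move=> t; have [h3 h4] := hull_bound z_bound t hu.
by apply: le_trans (ler_normB _ _) _; exact: lerD.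
Qed.

Lemma hull_integral m u (t : R) e : 0 <= t <= T -> hull m u ->
  ip (position u t - x0) e =
  segint 0 t (fun s => ip (field_part u s - normal_part u s) e).
Proof.
move=> tT; elim=> [i _|v w hv IHv hw IHw]; first exact: z_int.
have [mv bv] := hull_velocity hv; have [mw bw] := hull_velocity hw.
have kv : bounded_borel (fun s => ip (field_part v s - normal_part v s) e).
  by apply: (bounded_borel_ip_cst Hip) => //; exists (M + M).
have kw : bounded_borel (fun s => ip (field_part w s - normal_part w s) e).
  by apply: (bounded_borel_ip_cst Hip) => //; exists (M + M).
rewrite ipBl /= ip_midpoint.
have -> : (ip (position v t) e + ip (position w t) e) / 2 - ip x0 e =
    2^-1 * (ip (position v t - x0) e + ip (position w t - x0) e).
  by rewrite !ipBl; field.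
rewrite IHv IHw -segintD// -segintZ; last exact: bounded_borelD.
by congr segint; apply/funext => s; rewrite !ipBl !ip_midpoint; field.
Qed.

(** Positions of hull elements converge to [x] because those of the [z i] do, and
dominated convergence applies to the velocities. *)
Lemma velocity_limit : exists (v : nat -> trajectory) (u : R -> H),
  [/\ (forall m, hull m (v m)), strong_borel u, (forall t, `|u t| <= M + M),
      (forall (t : R) e, 0 <= t <= T ->
        ip (x t - x0) e = segint 0 t (fun s => ip (u s) e)) &
      {ae mu, forall t, 0 <= t <= T -> exists w g,
        [/\ (fun m => normal_part (v m) t) @ \oo --> w,
            (fun m => field_part (v m) t) @ \oo --> g & u t = g - w]}].
Proof.
have [v [hv [N [mN N0 subN]]]] := hull_cvg_ae Hip T_ge0 M_ge0 z_borel z_bound.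
pose A : set (measurableTypeR R) := `[0, T] `\` N.
have mA : measurable A by exact: measurableD.
have cA t : A t -> cvgn (fun m => normal_part (v m) t) /\
    cvgn (fun m => field_part (v m) t).
  move=> [/= tT Nt]; rewrite in_itv/= in tT.
  by apply: contrapT => h; apply: Nt; apply: subN => /= /(_ tT).
pose um m t := \1_A t *: (field_part (v m) t - normal_part (v m) t).
pose u t := \1_A t *:
  (limn (fun m => field_part (v m) t) - limn (fun m => normal_part (v m) t)).
have mum m : strong_borel (um m).
  by apply: strong_borel_indic => //; exact: (hull_velocity (hv m)).1.
have umu t : um^~ t @ \oo --> u t.
  rewrite /um /u; have [At|nAt] := pselect (A t); last first.
    rewrite indicE memNset// scale0r.
    by under eq_fun do rewrite scale0r; exact: cvg_cst.
  by have [c1 c2] := cA t At; apply: cvgZr; exact: cvgB.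
have mu_ : strong_borel u := strong_borel_lim mum umu.
have bum m t : `|um m t| <= M + M.
  rewrite /um indicE; case: (_ \in _); last by rewrite scale0r normr0 addr_ge0.
  by rewrite scale1r; exact: (hull_velocity (hv m)).2.
have bu t : `|u t| <= M + M.
  have h1 : (fun m => `|um m t|) @ \oo --> `|u t| by apply: cvg_norm; exact: umu.
  have h2 : (fun _ : nat => M + M) @ \oo --> M + M by exact: cvg_cst.
  by apply: (ler_cvg_to h1 h2); apply: nearW => m; exact: bum.
have inA : {ae mu, forall t, 0 <= t <= T -> A t}.
  by exists N; split => // t /=; apply: contra_notP => Nt tT; split => //=.
exists v, u; split => //.
- move=> t e tT.
  have lhs : (fun m => ip (position (v m) t - x0) e) @ \oo --> ip (x t - x0) e.
    apply: (cvg_ipl Hip); apply: cvgB; last exact: cvg_cst.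
    apply/cvgrPdist_le => d d0.
    have /cvgrPdist_le/(_ d d0) := @cvg_harmonic R.
    apply: filterS => m; rewrite sub0r normrN ger0_norm ?harmonic_ge0// => hm.
    by rewrite distrC; apply: le_trans hm; exact: hull_position.
  have bvm m : bounded_borel (fun s => ip (field_part (v m) s - normal_part (v m) s) e).
    have [h1 h2] := hull_velocity (hv m).
    by apply: (bounded_borel_ip_cst Hip) => //; exists (M + M).
  have rhs : segint 0 t (fun s => ip (field_part (v m) s - normal_part (v m) s) e)
      @[m --> \oo] --> segint 0 t (fun s => ip (u s) e).
    apply: (@segint_cvg _ _ _ _ _ ((M + M) * `|e|)) => //.
    + by apply: (bounded_borel_ip_cst Hip) => //; exists (M + M).
    + move=> m s _; apply: le_trans (ip_le_norm Hip _ _) _; apply: ler_wpM2r => //.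
      exact: (hull_velocity (hv m)).2.
    + apply: ae_imp inA => s hs /andP[s0 st]; have [_ tT'] := andP tT.
      have As : A s by apply: hs; rewrite s0 (le_trans st).
      have [c1 c2] := cA s As; rewrite /u indicE mem_set// scale1r.
      by apply: (cvg_ipl Hip); exact: cvgB.
  apply: (cvg_unique _ lhs) => //; move: rhs.
  rewrite (_ : (fun m => segint 0 t _) = (fun m => ip (position (v m) t - x0) e))//.
  by apply/funext => m; rewrite (hull_integral e tT (hv m)).
- apply: ae_imp inA => t At tT; have {}At := At tT.
  have [c1 c2] := cA t At.
  exists (limn (fun m => normal_part (v m) t)), (limn (fun m => field_part (v m) t)).
  by split => //; rewrite /u indicE mem_set// scale1r.
Qed.

End Limit.

(** Let [Ph j] be the primitive of [|u - d j|]. The increments of [x t - t *: d j]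
are bounded by those of [Ph j], so that at a point where each [Ph j] has the
derivative [|u t - d j|], all difference quotients of [x] are ultimately within
about [2 |u t - d j|] of [u t]; and [d] is dense in the range of [u]. *)
Lemma ae_derivable (R : realType) (H : normedModType R) (ip : {dot H for idfun})
    (Hip : induces_norm ip) (T : R) (x0 : H) (x u : R -> H) :
  strong_borel u -> norm_bounded u ->
  (forall (t : R) e, 0 <= t <= T ->
    ip (x t - x0) e = segint 0 t (fun s => ip (u s) e)) ->
  {ae @lebesgue_measure R, forall t, 0 < t < T ->
    derivable x t 1 /\ derive1 x t = u t}.
Proof.
move=> mu_ bu xint; have [d hd] := strong_borel_separable mu_.
pose ph j t := `|u t - d j|.
have bph j : bounded_borel (ph j).
  apply: (bounded_borel_vnorm Hip); first by apply: strong_borelB => //;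
    exact: strong_borel_cst.
  by apply: norm_boundedB => //; exists `|d j|.
pose Ph j t := segint 0 t (ph j).
have incr j (s t : R) : 0 <= s -> s <= t -> t <= T ->
    `|x t - x s - (t - s) *: d j| <= Ph j t - Ph j s.
  move=> s0 st tT.
  have -> : Ph j t - Ph j s = segint s t (ph j).
    by rewrite /Ph (segint_split s0 st)// addrAC subrr add0r.
  apply: (norm_le_segint Hip (u := fun t => u t - d j)).
  - by apply: strong_borelB => //; exact: strong_borel_cst.
  - by apply: norm_boundedB => //; exists `|d j|.
  - move=> e; have k1 := bounded_borel_ip_cst Hip e mu_ bu.
    rewrite (_ : (fun t => ip (u t - d j) e) = fun t => ip (u t) e - ip (d j) e);
      last first.
      by apply/funext => r; rewrite ipBl.
    rewrite segintB//; last exact: bounded_borel_cst.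
    rewrite segint_cst// ipBl ipZl mulrC; congr (_ - _).
    rewrite (_ : x t - x s = (x t - x0) - (x s - x0));
      last by rewrite opprB addrA subrK.
    rewrite ipBl !xint ?s0 ?tT ?(le_trans s0)// ?(le_trans st)//.
    by rewrite (segint_split s0 st k1) addrAC subrr add0r.
apply: ae_imp (ae_all_nat (fun j => segint_derivable (bph j))) => t ht /andP[t0 tT].
have main : (fun h => h^-1 *: (x (h + t) - x t)) @ 0^' --> u t.
  apply/cvgrPdist_lt => e e0; have e4 : 0 < e / 4 by rewrite divr_gt0.
  have [j hj] := hd t _ e4.
  have [dj dE] := ht j t0.
  have hPh : (fun h => h^-1 *: ((Ph j (h + t)) - Ph j t)) @ 0^' --> ph j t.
    rewrite -dE; move: dj; rewrite /derivable.
    rewrite (_ : (fun h => _) = fun h => h^-1 *: ((Ph j (h + t)) - Ph j t))//.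
    by apply/funext => h /=; rewrite [h%:A](mulr1).
  move/cvgrPdist_lt : hPh => /(_ _ e4) hPh.
  near=> h.
  have h0 : h != 0 by near: h; exact: nbhs_dnbhs_neq.
  have ht0 : 0 <= h + t <= T.
    have : `|h| < Num.min t (T - t).
      by near: h; apply: dnbhs0_lt; rewrite lt_min t0 subr_gt0.
    by rewrite lt_min !ltr_norml => /andP[/andP[h1 _] /andP[_ h2]]; lra.
  have [ht1 ht2] := andP ht0.
  have hq : `|ph j t - h^-1 *: (Ph j (h + t) - Ph j t)| < e / 4 by near: h.
  have q1 : `|x (h + t) - x t - h *: d j| <= `|Ph j (h + t) - Ph j t|.
    have [hle|hlt] := leP 0 h.
      have := incr j t (h + t) (ltW t0) _ ht2; rewrite addrK lerDr => /(_ hle) hi.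
      exact: le_trans hi (ler_norm _).
    have := incr j (h + t) t ht1 _ (ltW tT); rewrite gerDr => /(_ (ltW hlt)) hi.
    rewrite -normrN (distrC (Ph j _)); apply: le_trans (ler_norm _).
    apply: le_trans hi; rewrite le_eqVlt; apply/orP; left; apply/eqP; congr `|_|.
    rewrite opprD opprB; congr (_ + _).
    by rewrite -!scaleNr; congr (_ *: _); ring.
  have q2 : `|h^-1 *: (x (h + t) - x t) - d j| <= `|h^-1 *: (Ph j (h + t) - Ph j t)|.
    have -> : h^-1 *: (x (h + t) - x t) - d j = h^-1 *: (x (h + t) - x t - h *: d j).
      by rewrite [RHS]scalerBr scalerA mulVf// scale1r.
    by rewrite !normrZ ler_pM2l// normr_gt0 invr_eq0.
  have q3 : `|h^-1 *: (Ph j (h + t) - Ph j t)| <= ph j t + e / 4.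
    rewrite -(subrK (ph j t) (h^-1 *: _)); apply: le_trans (ler_normD _ _) _.
    rewrite distrC addrC (ger0_norm (normr_ge0 _)) lerD2l; exact: ltW.
  apply: le_lt_trans (ler_distD (d j) _ _) _.
  rewrite (distrC (d j)); move: hj q2 q3; rewrite /ph; lra.
split; last exact: cvg_lim main.
apply/cvg_ex; exists (u t); move: main.
by rewrite (_ : (fun h => _) = fun h => h^-1 *: ((x \o shift t) (h *: 1) - x t))//;
  apply/funext => h /=; rewrite [h%:A](mulr1).
Unshelve. all: by end_near. Qed.

(** * Passing to the limit at a fixed time *)

Section HullLimits.
Context {R : realType} {H : completeNormedModType R} (ip : {dot H for idfun}).
Hypothesis Hip : induces_norm ip.

Lemma tail_hull_map (V W : Type) (midV : V -> V -> V) (midW : W -> W -> W)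
    (p : V -> W) (z : nat -> V) m v :
  (forall u v, p (midV u v) = midW (p u) (p v)) ->
  tail_hull midV z m v -> tail_hull midW (p \o z) m (p v).
Proof.
move=> pmid; elim=> [i mi|u w _ hu _ hw].
  exact: (tail_hull_gen midW (p \o z) mi).
by rewrite pmid; exact: tail_hull_mid.
Qed.

Section Pointwise.
Variables (a v : nat -> H) (w : H).
Hypotheses (hull_v : forall m, tail_hull (@midpoint R H) a m (v m))
  (vw : v @ \oo --> w).

Lemma hull_limit_ip_le e (b : R) : (\forall i \near \oo, ip (a i) e <= b) ->
  ip w e <= b.
Proof.
move=> [N _ hN].
have h1 : (fun m => ip (v m) e) @ \oo --> ip w e.
  exact: (cvg_ipl Hip).
have h2 : (fun _ : nat => b) @ \oo --> b by exact: cvg_cst.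
apply: (ler_cvg_to h1 h2); exists N => // m /= Nm.
elim: (hull_v m) => [i mi|u u' _ hu _ hu']; first by apply: hN; exact: leq_trans mi.
rewrite ip_midpoint ler_pdivrMr// mulr_natr mulr2n; exact: lerD.
Qed.

Lemma hull_limit_norm_le (b : R) : (\forall i \near \oo, `|a i| <= b) -> `|w| <= b.
Proof.
move=> [N _ hN].
have h1 : (fun m => `|v m|) @ \oo --> `|w| by exact: cvg_norm.
have h2 : (fun _ : nat => b) @ \oo --> b by exact: cvg_cst.
apply: (ler_cvg_to h1 h2); exists N => // m /= Nm.
elim: (hull_v m) => [i mi|u u' _ hu _ hu']; first by apply: hN; exact: leq_trans mi.
exact: midpoint_norm_le.
Qed.

End Pointwise.
End HullLimits.

(** Apply the almost minimality of [q i] to the point [c i + s *: ds i] of [C],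
where [ds] converges to [d] and [s = m * th]. With [th ^ 2] equal to the sum of
the relative errors [eps / m ^ 2] and [eta / m], this [s] is small compared with
[m], which makes the quadratic term harmless, and large enough for the errors
to vanish after division by [m * s]. *)
Lemma clarke_normal_limit (R : realType) (H : normedModType R)
    (ip : {dot H for idfun}) (Hip : induces_norm ip) (C : set H) (x d : H) (M : R)
    (W c q : nat -> H) (m eps eta : nat -> R) :
  (forall i, 0 < m i) -> m @ \oo --> (0 : R) ->
  (forall i, 0 < eps i) -> (forall i, 0 < eta i) ->
  (fun i => eps i / m i ^+ 2) @ \oo --> (0 : R) ->
  (fun i => eta i / m i) @ \oo --> (0 : R) ->
  (forall i, C (c i)) -> c @ \oo --> x ->
  (forall i, `|q i - c i| <= eta i) -> (forall i, `|W i| <= M) ->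
  (forall i c', C c' ->
    `|m i *: W i| ^+ 2 <= `|m i *: W i + q i - c'| ^+ 2 + eps i) ->
  clarke_tangent C x d ->
  forall e, 0 < e -> \forall i \near \oo, ip (W i) d <= e.
Proof.
move=> m0 mlim eps0 eta0 epslim etalim Cc cx qc WM prox dT e e0.
pose th i := Num.sqrt (eps i / m i ^+ 2 + eta i / m i).
have a0 i : 0 < eps i / m i ^+ 2 + eta i / m i.
  by rewrite addr_gt0 ?divr_gt0 ?exprn_gt0.
have th0 i : 0 < th i by rewrite sqrtr_gt0.
have thE i : th i ^+ 2 = eps i / m i ^+ 2 + eta i / m i by rewrite sqr_sqrtr ?ltW.
have thlim : th @ \oo --> (0 : R).
  rewrite -(@sqrtr0 R); apply: continuous_cvg; first exact: sqrt_continuous.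
  by rewrite -[X in _ --> X](addr0 0); exact: cvgD.
have slim : (fun i => m i * th i) @ \oo --> (0 : R).
  by rewrite -[X in _ --> X](mulr0 0); exact: cvgM.
have [ds [dd Cd]] := dT c (fun i => m i * th i) Cc cx
  (fun i => mulr_gt0 (m0 i) (th0 i)) slim.
have M0 : 0 <= M by exact: le_trans (WM 0%N).
have key i : ip (W i) (ds i) <=
    M * th i + th i ^+ 3 + th i * `|ds i| ^+ 2 + th i / 2.
  have := prox i _ (Cd i); set s := m i * th i.
  have mi := m0 i; have ti := th0 i.
  have -> : m i *: W i + q i - (c i + s *: ds i) =
      m i *: W i + ((q i - c i) - s *: ds i) by rewrite opprD !addrA.
  rewrite (normD_sqr Hip) (normB_sqr Hip) ipZl ipBr !ipZr.
  set E := q i - c i; set D := `|ds i|; set I := ip (W i) (ds i).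
  have s0 : 0 < s by exact: mulr_gt0.
  rewrite (normrZ s) (ger0_norm (ltW s0)) -/D exprMn.
  have h1 : ip (W i) E <= M * eta i.
    by apply: le_trans (ip_le Hip _ _) _; apply: ler_pM => //; exact: qc.
  have h2 : - ip E (ds i) <= eta i * D.
    apply: le_trans (ler_norm _) _; rewrite normrN.
    by apply: le_trans (ip_le_norm Hip _ _) _; apply: ler_wpM2r => //; exact: qc.
  have h3 : `|E| ^+ 2 <= eta i ^+ 2.
    by rewrite ler_pXn2r ?nnegrE//; [exact: qc|exact: ltW].
  have h4 : eta i <= m i * th i ^+ 2.
    rewrite thE mulrDr (mulrC (m i) (eta i / _)) divfK ?gt_eqF// lerDr.
    by rewrite mulr_ge0 ?divr_ge0 ?exprn_ge0// ltW.
  have h5 : eps i <= (m i * th i) ^+ 2.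
    rewrite exprMn thE mulrDr mulrC divfK ?gt_eqF ?exprn_gt0// lerDl.
    by rewrite mulr_ge0 ?divr_ge0 ?exprn_ge0// ltW.
  rewrite -/s in h5.
  have D0 : 0 <= D by exact: normr_ge0.
  have eta_i := eta0 i.
  move=> h.
  have h6 : 2 * m i * s * I <= 2 * m i * (M * eta i) + eta i ^+ 2
      + 2 * s * (eta i * D) + s ^+ 2 * D ^+ 2 + eps i.
    have k1 : m i * ip (W i) E <= m i * (M * eta i) by rewrite ler_pM2l.
    have k2 : s * (- ip E (ds i)) <= s * (eta i * D) by rewrite ler_pM2l.
    by move: h k1 k2 h3; rewrite -/I; nra.
  have h7 : 2 * s * (eta i * D) <= eta i ^+ 2 + s ^+ 2 * D ^+ 2.
    by have := sqr_ge0 (eta i - s * D); rewrite sqrrB exprMn; lra.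
  have h8 : eta i ^+ 2 <= (m i * th i ^+ 2) ^+ 2.
    by rewrite ler_pXn2r ?nnegrE ?mulr_ge0 ?exprn_ge0// ltW.
  have h9 : m i * (M * eta i) <= m i * (M * (m i * th i ^+ 2)).
    by rewrite ler_pM2l// ler_wpM2l.
  have p0 : 0 < 2 * m i * s by rewrite !mulr_gt0.
  rewrite -(ler_pM2l p0).
  have -> : 2 * m i * s * (M * th i + th i ^+ 3 + th i * D ^+ 2 + th i / 2) =
    2 * (m i * (M * (m i * th i ^+ 2))) + 2 * (m i * th i ^+ 2) ^+ 2
     + 2 * (s ^+ 2 * D ^+ 2) + s ^+ 2 by rewrite /s; field.
  by lra.
have rhs : (fun i => M * th i + th i ^+ 3 + th i * `|ds i| ^+ 2 + th i / 2
    + M * `|d - ds i|) @ \oo --> (0 : R).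
  have dn : (fun i => `|ds i|) @ \oo --> `|d| by exact: cvg_norm.
  have -> : 0 = M * 0 + 0 * (0 * 0) + 0 * (`|d| * `|d|) + 0 * 2^-1 + M * `|d - d|.
    by rewrite subrr normr0; ring.
  apply: cvgD; last first.
    by apply: cvgM; [exact: cvg_cst|apply: cvg_norm; apply: cvgB => //;
      exact: cvg_cst].
  apply: cvgD; last by apply: cvgM => //; exact: cvg_cst.
  apply: cvgD; last by apply: cvgM => //; under eq_fun do rewrite expr2; exact: cvgM.
  apply: cvgD; first by apply: cvgM => //; exact: cvg_cst.
  by under eq_fun do rewrite !exprS expr0 mulr1; do 2 apply: cvgM => //.
move/cvgrPdist_lt : rhs => /(_ e e0); apply: filterS => i; rewrite sub0r normrN => hi.
rewrite -(subrK (ds i) d) ipDr addrC;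
  apply: le_trans (ltW (le_lt_trans (ler_norm _) hi)).
apply: lerD; first exact: key.
by apply: le_trans (ip_le Hip _ _) _; apply: ler_wpM2r.
Qed.

(** The half-space [b <= (., e)] is weakly closed and does not meet [G x]; by upper
semicontinuity it does not meet [G (z i)] for large [i]. *)
Lemma usc_limit (R : realType) (H : completeNormedModType R)
    (ip : {dot H for idfun}) (Hip : induces_norm ip) (G : H -> set H) (x e : H)
    (z v : nat -> H) (a b : R) :
  usc_to_weak G -> z @ \oo --> x -> (forall i, G (z i) (v i)) ->
  (forall w, G x w -> ip w e <= a) -> a < b ->
  \forall i \near \oo, ip (v i) e <= b.
Proof.
move=> Gusc zx Gv Gxa ab.
have cl := Gusc _ (@halfspace_weakly_closed _ _ _ Hip e b).
pose S := [set x' | G x' `&` [set w | b <= ip w e] !=set0].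
have xS : ~ S x.
  by move=> [w [Gw /= bw]]; have := le_lt_trans (le_trans bw (Gxa w Gw)) ab;
    rewrite ltxx.
have ev : \forall i \near \oo, (~` S) (z i).
  exact: (zx _ (open_nbhs_nbhs (conj (closed_openC cl) xS))).
apply: filterS ev => i nS; rewrite leNgt; apply/negP => bi; apply: nS.
by exists (v i); split => //=; exact: ltW.
Qed.

Lemma cvg_dist_squeeze (R : realType) (H : normedModType R) (p z : nat -> H)
    (r : nat -> R) (x : H) :
  p @ \oo --> x -> r @ \oo --> (0 : R) -> (forall i, `|p i - z i| <= r i) ->
  z @ \oo --> x.
Proof.
move=> px r0 pz; apply/cvgrPdist_lt => e e0; have e2 : 0 < e / 2 by rewrite divr_gt0.
move/cvgrPdist_lt : px => /(_ _ e2); move/cvgrPdist_lt : r0 => /(_ _ e2).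
apply: filterS2 => i; rewrite sub0r normrN => ri pi.
apply: le_lt_trans (ler_distD (p i) _ _) _; rewrite [ltRHS]splitr ltrD//.
by apply: le_lt_trans (pz i) _; exact: le_lt_trans (ler_norm _) ri.
Qed.

Section PointwiseLimit.
Context {R : realType} {H : completeNormedModType R} (ip : {dot H for idfun}).
Hypothesis Hip : induces_norm ip.
Variables (C : set H) (G : H -> set H) (h : H -> R) (L gam M t : R) (x w g : H).
Variables (zt v : nat -> trajectory (H := H)) (a q : nat -> H)
  (m eps eta err r : nat -> R).
Hypotheses (C_closed : closed C) (G_usc : usc_to_weak G) (G_nonempty : G x !=set0)
  (G_closed : closed (G x)) (G_convex : convex_set (G x)).
Hypotheses (L_gt0 : 0 < L) (h_lip : forall z z', h z <= h z' + L * `|z - z'|).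
Hypotheses (m_gt0 : forall i, 0 < m i) (eps_gt0 : forall i, 0 < eps i)
  (eta_gt0 : forall i, 0 < eta i) (m_cvg : m @ \oo --> (0 : R))
  (eps_cvg : (fun i => eps i / m i ^+ 2) @ \oo --> (0 : R))
  (eta_cvg : (fun i => eta i / m i) @ \oo --> (0 : R))
  (err_cvg : err @ \oo --> (0 : R)) (r_cvg : r @ \oo --> (0 : R)).
Hypotheses (hull_v : forall k, tail_hull mid_trajectory zt k (v k))
  (w_cvg : (fun k => normal_part (v k) t) @ \oo --> w)
  (g_cvg : (fun k => field_part (v k) t) @ \oo --> g)
  (position_cvg : (fun i => position (zt i) t) @ \oo --> x).
Hypotheses (a_near : forall i, `|position (zt i) t - a i| <= r i)
  (q_near : forall i, `|position (zt i) t - q i| <= r i)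
  (field_in : forall i, G (a i) (field_part (zt i) t))
  (field_le : forall i, `|field_part (zt i) t| <= h (a i) + gam)
  (normal_le : forall i, `|normal_part (zt i) t| <= h (a i) + gam + err i)
  (normal_bound : forall i, `|normal_part (zt i) t| <= M)
  (normal_proj : forall i,
    almost_projection C (eps i) (eta i) (m i *: normal_part (zt i) t) (q i)).

Let a_cvg : a @ \oo --> x. Proof. exact: cvg_dist_squeeze position_cvg r_cvg a_near. Qed.

Let q_cvg : q @ \oo --> x. Proof. exact: cvg_dist_squeeze position_cvg r_cvg q_near. Qed.

(** Otherwise a half-space strictly separates [g] from [G x]; late terms of the
sequence, hence [g], are on the side of [G x]. *)
Lemma limit_field_in : G x g.
Proof.
apply: contrapT => nGg.
have [e [b [bg Gb]]] := separation Hip G_nonempty G_closed G_convex nGg.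
pose b' := (b + ip g e) / 2.
have bb' : b < b' by rewrite /b'; lra.
have ev := usc_limit Hip G_usc a_cvg field_in Gb bb'.
have hf : forall k, tail_hull (@midpoint R H) (fun i => field_part (zt i) t) k
    (field_part (v k) t).
  by move=> k; apply: (tail_hull_map (p := fun u => field_part u t)) (hull_v k).
have := hull_limit_ip_le Hip hf g_cvg ev.
by rewrite /b'; lra.
Qed.

Lemma limit_normal_in : clarke_normal ip C x w.
Proof.
have [c hc] := choice (fun i => let: ex_intro2 c Cc cP := normal_proj i in
  ex_intro (fun c => C c /\ _) c (conj Cc cP)).
have etal : eta @ \oo --> (0 : R).
  rewrite -[X in _ --> X](mulr0 0).
  rewrite (_ : eta = fun i => eta i / m i * m i); first exact: cvgM.
  by apply/funext => i; rewrite divfK ?gt_eqF.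
have c_cvg : c @ \oo --> x.
  by apply: cvg_dist_squeeze q_cvg etal _ => i; exact: (hc i).2.1.
split.
  by apply: (closed_cvg _ C_closed) c_cvg; apply: nearW => i; exact: (hc i).1.
move=> d dT; apply/ler_addgt0Pr => e e0; rewrite add0r.
have hw : forall k, tail_hull (@midpoint R H) (fun i => normal_part (zt i) t) k
    (normal_part (v k) t).
  by move=> k; apply: (tail_hull_map (p := fun u => normal_part u t)) (hull_v k).
apply: (hull_limit_ip_le Hip hw w_cvg).
apply: (clarke_normal_limit Hip m_gt0 m_cvg eps_gt0 eta_gt0 eps_cvg eta_cvg
  (fun i => (hc i).1) c_cvg _ normal_bound _ dT e0).
- by move=> i; exact: (hc i).2.1.
- by move=> i; exact: (hc i).2.2.
Qed.

(** Both parts are bounded by [h (a i) + gam] up to an error, and [a i] converges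
to [x]. *)
Lemma limit_velocity_le : `|g - w| <= 2 * (h x + gam).
Proof.
apply/ler_addgt0Pr => e e0.
have hd : forall k, tail_hull (@midpoint R H)
    (fun i => field_part (zt i) t - normal_part (zt i) t) k
    (field_part (v k) t - normal_part (v k) t).
  move=> k; apply: (tail_hull_map (p := fun u => field_part u t - normal_part u t))
    (hull_v k) => u u' /=.
  by rewrite /midpoint -scalerBr opprD addrACA.
apply: (hull_limit_norm_le hd); first exact: cvgB.
have e2 : 0 < e / 2 by rewrite divr_gt0.
have e4 : 0 < e / (4 * L) by rewrite divr_gt0// mulr_gt0.
move/cvgrPdist_lt : err_cvg => /(_ _ e2); move/cvgrPdist_lt : a_cvg => /(_ _ e4).
apply: filterS2 => i ai; rewrite sub0r normrN => erri.
apply: le_trans (ler_normB _ _) _.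
apply: le_trans (lerD (field_le i) (normal_le i)) _.
have := h_lip (a i) x; rewrite distrC => hl.
have hl2 : L * `|x - a i| <= e / 4.
  apply: le_trans (ler_wpM2l (ltW L_gt0) (ltW ai)) _.
  by rewrite le_eqVlt; apply/orP; left; apply/eqP; field; rewrite gt_eqF.
by have := ler_norm (err i); lra.
Qed.

End PointwiseLimit.

(** * Convergence of the inexact catching-up algorithm *)

Lemma subsequence_cvg (X : topologicalType) (u : nat -> X) (l : X)
    (phi : nat -> nat) :
  {homo phi : i j / (i < j)%N} -> u @ \oo --> l -> (fun i => u (phi i)) @ \oo --> l.
Proof.
move=> phi_inc ul.
have phi_ge i : (i <= phi i)%N.
  by elim: i => // i IH; apply: leq_ltn_trans IH _; exact: phi_inc.
by move=> U /ul [N _ hN]; exists N => // i /= Ni; apply: hN;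
  exact: leq_trans (phi_ge i).
Qed.

Lemma lipschitz_abs_continuous (R : realType) (H : normedModType R) (a b K : R)
    (x : R -> H) : 0 <= K ->
  (forall s t : R, a <= s -> s <= t -> t <= b -> `|x t - x s| <= K * (t - s)) ->
  abs_continuous a b x.
Proof.
move=> K0 xK e e0; have K1 : 0 < K + 1 by rewrite ltr_wpDl.
exists (e / (K + 1)) => [|m s t hst _ sum_lt]; first by rewrite divr_gt0.
apply: (@le_lt_trans _ _ ((K + 1) * \sum_(i < m) (t i - s i))).
  rewrite mulr_sumr; apply: ler_sum => i _; have [as_ st tb] := hst i.
  apply: le_trans (xK _ _ as_ st tb) _; rewrite ler_wpM2r ?subr_ge0//.
  by rewrite lerDl.
by rewrite mulrC -ltr_pdivlMr.
Qed.

Lemma lipschitz_on_segment (R : realType) (H : normedModType R) (a b K : R)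
    (x : R -> H) :
  (forall s t : R, a <= s -> s <= t -> t <= b -> `|x t - x s| <= K * (t - s)) ->
  K.-lipschitz_`[a, b] (x : R^o -> H).
Proof.
move=> xK [s t] [] /=; rewrite !in_itv/= => /andP[as_ sb] /andP[at_ tb].
have [st|/ltW ts] := leP s t.
  by rewrite distrC (distrC s) (ger0_norm (x := t - s)) ?subr_ge0//; exact: xK.
by rewrite (ger0_norm (x := s - t)) ?subr_ge0//; exact: xK.
Qed.

Lemma uniform_cvg_of_bound (R : realType) (H : normedModType R) (A : set R)
    (X : nat -> R -> H) (x : R -> H) (r : nat -> R) : r @ \oo --> (0 : R) ->
  (forall i t, A t -> `|X i t - x t| <= r i) -> {uniform A, X @ \oo --> x}.
Proof.
move=> r0 Xx P /uniform_nbhs[E [entE EP]].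
move: entE; rewrite -entourage_ballE => -[e /= e0 eE].
move/cvgrPdist_lt : r0 => /(_ e e0); apply: filterS => i; rewrite sub0r normrN => ri.
apply: EP => t At; apply: eE; rewrite /= -ball_normE /= distrC.
by apply: le_lt_trans (Xx i t At) _; exact: le_lt_trans (ler_norm _) ri.
Qed.

Theorem theorem6p1 (R : realType) (H : completeNormedModType R)
  (ip : {dot H for idfun}) (Hip : induces_norm ip)
  (T : R) (T_gt0 : 0 < T)
  (C : set H) (C_compact : ball_compact C) (x0 : H) (Cx0 : C x0)
  (F : R -> H -> set H)
  (F_nonempty : forall t x, 0 <= t <= T -> F t x !=set0)
  (F_closed : forall t x, 0 <= t <= T -> closed (F t x))
  (F_convex : forall t x, 0 <= t <= T -> convex_set (F t x))
  (F_usc : forall t, 0 <= t <= T -> usc_to_weak (F t))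
  (h : H -> R) (h_ge0 : forall x, 0 <= h x)
  (Lh : R) (Lh_gt0 : 0 < Lh) (h_lip : Lh.-lipschitz (h : H -> R^o))
  (F_bound : forall x, {ae (@lebesgue_measure R), forall t, 0 <= t <= T ->
                          dist_set (F t x) 0 <= h x})
  (gamma : R) (gamma_gt0 : 0 < gamma) (f : R -> H -> H)
  (f_proj : forall t x, 0 <= t <= T -> approx_proj (F t x) gamma 0 (f t x))
  (f_meas : forall x, strongly_measurable 0 T (f^~ x))
  (eps eta : nat -> R)
  (eps_gt0 : forall n, (0 < n)%N -> 0 < eps n)
  (eta_gt0 : forall n, (0 < n)%N -> 0 < eta n)
  (eps_lim : (fun n => eps n / (T / n%:R) ^+ 2) @ \oo --> (0 : R))
  (eta_lim : (fun n => eta n / (T / n%:R)) @ \oo --> (0 : R))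
  (Ceta : nat -> set H)
  (Ceta_enl : forall n, (0 < n)%N -> enlargement C (eta n) (Ceta n))
  (y : nat -> nat -> H) (xs : nat -> R -> H)
  (xs_gen : forall n, (0 < n)%N ->
     catching_up T C (Ceta n) f x0 (eps n) n (y n) (xs n)) :
  exists (phi : nat -> nat) (x : R -> H),
    [/\ (forall i, (0 < phi i)%N) /\ {homo phi : i j / (i < j)%N},
        {uniform `[0, T], (fun i => xs (phi i)) @ \oo --> x},
        (exists K : R, K.-lipschitz_`[0, T] (x : R^o -> H)),
        sweeping_solution ip T C F x0 x &
        {ae (@lebesgue_measure R), forall t, 0 <= t <= T ->
           `|derive1 x t| <= 2 * (h (x t) + Num.sqrt gamma)}].
Proof.
set gam := Num.sqrt gamma; have gam0 : 0 <= gam by exact: sqrtr_ge0.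
have f_bound z : {ae @lebesgue_measure R, forall t, 0 <= t <= T ->
    `|f t z| <= h z + gam}.
  apply: ae_imp (F_bound z) => t dh tT; have [_] := f_proj t z tT.
  rewrite sub0r normrN => fd.
  apply: le_trans (le_sqrtD (normr_ge0 _) (dist_set_ge0 _ _) (ltW gamma_gt0) fd) _.
  by rewrite lerD2r; exact: dh.
have h_lip1 z z' : h z <= h z' + Lh * `|z - z'|.
  have := h_lip (z, z') (conj I I); rewrite /= => hz.
  by rewrite -lerBlDl; apply: le_trans hz; exact: ler_norm.
pose m n : R := T / n%:R.
pose err n := (eta n + Num.sqrt (eps n)) / m n.
have m_gt0 i : 0 < m i.+1 by rewrite divr_gt0.
have m_cvg : (fun i => m i.+1) @ \oo --> (0 : R).
  rewrite -(mulr0 T); apply: cvgM; first exact: cvg_cst.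
  exact: cvg_harmonic.
have shift_cvg (u : nat -> R) (l : R) : u @ \oo --> l ->
  (fun i => u i.+1) @ \oo --> l.
  exact: (@subsequence_cvg R u l succn).
have err_cvg : (fun i => err i.+1) @ \oo --> (0 : R).
  have -> : (fun i => err i.+1) =
      (fun i => eta i.+1 / m i.+1 + Num.sqrt (eps i.+1 / m i.+1 ^+ 2)).
    apply/funext => i; rewrite /err mulrDl; congr (_ + _).
    rewrite sqrtrM ?(ltW (eps_gt0 _ _))// sqrtrV ?sqr_ge0// sqrtr_sqr ger0_norm//.
    exact: ltW.
  rewrite -(addr0 0); apply: cvgD; first exact: (shift_cvg _ _ eta_lim).
  rewrite -(@sqrtr0 R); apply: continuous_cvg; first exact: sqrt_continuous.
  exact: (shift_cvg _ _ eps_lim).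
have [B errB] : exists B, forall i, err i.+1 <= B.
  have [M [_ hM]] := cvg_seq_bounded (cvgP _ err_cvg).
  exists (M + 1) => i; apply: le_trans (ler_norm _) _.
  by apply: hM => //; rewrite ltrDl.
pose M := speed T x0 h gam Lh B.
have scheme i : exists z : trajectory (H := H), position z = xs i.+1 /\
  [/\ (strong_borel (normal_part z) /\ strong_borel (field_part z)),
      (forall t, `|normal_part z t| <= M /\ `|field_part z t| <= M),
      (forall (t : R) e, 0 <= t <= T -> ip (xs i.+1 t - x0) e =
        segint 0 t (fun s => ip (field_part z s - normal_part z s) e)),
      (forall s t : R, 0 <= s -> s <= t -> t <= T ->
        `|xs i.+1 t - xs i.+1 s| <= 2 * M * (t - s)) &
      (forall t : R, 0 <= t <= T -> exists2 c, C c &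
        `|xs i.+1 t - c| <= 2 * M * m i.+1 + eta i.+1)] /\
  {ae @lebesgue_measure R, forall t, 0 < t <= T -> exists a q,
    [/\ `|xs i.+1 t - a| <= 2 * M * m i.+1, `|xs i.+1 t - q| <= 2 * M * m i.+1,
        field_part z t = f t a /\ `|field_part z t| <= h a + gam,
        `|normal_part z t| <= h a + gam + err i.+1 &
        almost_projection C (eps i.+1) (eta i.+1) (m i.+1 *: normal_part z t) q]}.
  have [W [V [[h1 h2 h3 h4 h5] [h6 h7 h8]]]] := scheme_velocity Hip T_gt0 Cx0 h_ge0
    (ltW Lh_gt0) h_lip1 gam0 (eps_gt0 i.+1 isT) (eta_gt0 i.+1 isT) (ltn0Sn i)
    (Ceta_enl i.+1 isT) f_meas f_bound (xs_gen i.+1 isT) (errB i).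
  by exists (Trajectory W V (xs i.+1)).
have [zt hz] := choice scheme.
have M0 : 0 <= M.
  by have [_ [[_ hM _ _ _] _]] := hz 0%N; exact: le_trans (hM 0).1.
have xs0 i : xs i.+1 0 = x0 by have [] := xs_gen i.+1 isT.
have eta_cvg : (fun i => eta i.+1) @ \oo --> (0 : R).
  rewrite -(mulr0 0) (_ : (fun i => _) = fun i => eta i.+1 / m i.+1 * m i.+1).
    by apply: cvgM => //; exact: (shift_cvg _ _ eta_lim).
  by apply/funext => i; rewrite divfK ?gt_eqF.
have r_cvg : (fun i => 2 * M * m i.+1) @ \oo --> (0 : R).
  by rewrite -(mulr0 (2 * M)); apply: cvgM => //; exact: cvg_cst.
have M2 : 0 <= 2 * M by rewrite mulr_ge0.
have [|||||phi [x [phi_inc Cx Xx]]] := @uniform_subsequence R H T (2 * M)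
    (`|x0| + 2 * M * T) C (fun i => xs i.+1)
    (fun i => 2 * M * m i.+1 + eta i.+1) T_gt0 M2 _ C_compact.
- by rewrite addr_ge0// mulr_ge0// ltW.
- by move=> i; have [_ [[_ _ _ hi _] _]] := hz i.
- move=> i t /andP[t0 tT]; have [_ [[_ _ _ hi _] _]] := hz i.
  have := hi 0 t (lexx _) t0 tT; rewrite xs0 subr0 => hxt.
  rewrite -(subrK x0 (xs i.+1 t)) addrC; apply: le_trans (ler_normD _ _) _.
  by rewrite lerD2l; apply: le_trans hxt _; rewrite ler_wpM2l.
- by move=> i; have [_ [[_ _ _ _ hi] _]] := hz i.
- by rewrite -(addr0 0); exact: cvgD.
have Xcvg t : 0 <= t <= T -> (fun i => xs (phi i).+1 t) @ \oo --> x t.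
  move=> tT; apply: (cvg_dist_squeeze (p := fun=> x t) (r := harmonic)).
  - exact: cvg_cst.
  - exact: cvg_harmonic.
  - by move=> i; rewrite distrC; exact: Xx.
have x_lip (s t : R) : 0 <= s -> s <= t -> t <= T -> `|x t - x s| <= 2 * M * (t - s).
  move=> s0 st tT.
  have c1 : (fun i => `|xs (phi i).+1 t - xs (phi i).+1 s|) @ \oo --> `|x t - x s|.
    by apply: cvg_norm; apply: cvgB; apply: Xcvg;
      rewrite ?tT ?s0 ?(le_trans s0 st) ?(le_trans st tT).
  have c2 : (fun _ : nat => 2 * M * (t - s)) @ \oo --> 2 * M * (t - s).
    exact: cvg_cst.
  apply: (ler_cvg_to c1 c2); apply: nearW => i.
  by have [_ [[_ _ _ hi _] _]] := hz (phi i); exact: hi.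
have x_0 : x 0 = x0.
  have h0 : (fun i => xs (phi i).+1 0) @ \oo --> x 0 by apply: Xcvg; rewrite lexx ltW.
  have h1 : (fun i => xs (phi i).+1 0) @ \oo --> x0.
    rewrite (_ : (fun i => _) = fun=> x0); first exact: cvg_cst.
    by apply/funext => i; exact: xs0.
  exact: (cvg_unique _ h0 h1).
pose zp i := zt (phi i).
have [||||v [u [hull_v mu_ bu xint uwg]]] := @velocity_limit R H ip Hip T M x0 x zp
    (ltW T_gt0) M0.
- by move=> i; have [_ [[hi _ _ _ _] _]] := hz (phi i).
- by move=> i; have [_ [[_ hi _ _ _] _]] := hz (phi i).
- by move=> i; have [-> [[_ _ hi _ _] _]] := hz (phi i).
- by move=> i t tT; have [-> _] := hz (phi i); exact: Xx.
have vbu : norm_bounded u by exists (M + M).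
have der := ae_derivable Hip mu_ vbu xint.
have cells := ae_all_nat (fun i => (hz (phi i)).2.2).
(* [ae_derivable] only speaks of the open interval *)
have ends : {ae @lebesgue_measure R, forall t, t <> 0 /\ t <> T}.
  apply: ae_and; [exists [set 0]|exists [set T]]; split => //;
    try exact: lebesgue_measure_set1; by move=> t /= /contrapT.
have main : {ae @lebesgue_measure R, forall t, 0 <= t <= T -> derivable x t 1 /\
    exists w g, [/\ clarke_normal ip C (x t) w, F t (x t) g, derive1 x t = g - w &
      `|g - w| <= 2 * (h (x t) + gam)]}.
  apply: ae_imp (ae_and (ae_and uwg der) (ae_and cells ends)).
  move=> t [[uwgt dert] [cellst [t0 tT]]] tI.
  have {t0 tT}tI' : 0 < t < T.
    have /andP[h0 hT] := tI; rewrite !lt_neqAle h0 hT !andbT.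
    by apply/andP; split; apply/eqP => //; exact/nesym.
  have tI2 : 0 < t <= T by have /andP[-> /ltW->] := tI'.
  have [dx dxE] := dert tI'; have [w [g [wc gc uE]]] := uwgt tI.
  split => //; exists w, g.
  have cell_pick i : exists aq : H * H,
    [/\ `|xs (phi i).+1 t - aq.1| <= 2 * M * m (phi i).+1,
        `|xs (phi i).+1 t - aq.2| <= 2 * M * m (phi i).+1,
        field_part (zp i) t = f t aq.1 /\ `|field_part (zp i) t| <= h aq.1 + gam,
        `|normal_part (zp i) t| <= h aq.1 + gam + err (phi i).+1 &
        almost_projection C (eps (phi i).+1) (eta (phi i).+1)
          (m (phi i).+1 *: normal_part (zp i) t) aq.2].
    by have [a [q aqP]] := cellst i tI2; exists (a, q).
  have [aq haq] := choice cell_pick.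
  have pos_cvg : (fun i => position (zp i) t) @ \oo --> x t.
    rewrite (_ : (fun i => _) = fun i => xs (phi i).+1 t); first exact: Xcvg.
    by apply/funext => i; rewrite (hz (phi i)).1.
  have a_near i : `|position (zp i) t - (aq i).1| <= 2 * M * m (phi i).+1.
    by rewrite (hz (phi i)).1; have [] := haq i.
  have q_near i : `|position (zp i) t - (aq i).2| <= 2 * M * m (phi i).+1.
    by rewrite (hz (phi i)).1; have [] := haq i.
  have sub_cvg (r : nat -> R) (l : R) : (fun i => r i.+1) @ \oo --> l ->
      (fun i => r (phi i).+1) @ \oo --> l.
    exact: (@subsequence_cvg R (fun i => r i.+1)).
  have a_field i : F t (aq i).1 (field_part (zp i) t).
    by have [_ _ [-> _] _ _] := haq i; have [] := f_proj t (aq i).1 tI.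
  have r_sub : (fun i => 2 * M * m (phi i).+1) @ \oo --> (0 : R).
    exact: (sub_cvg (fun i => 2 * M * m i)).
  split.
  - apply: (@limit_normal_in R H ip Hip C M t (x t) w zp v (fun i => (aq i).2)
      (fun i => m (phi i).+1) (fun i => eps (phi i).+1) (fun i => eta (phi i).+1)
      (fun i => 2 * M * m (phi i).+1)) => //.
    + exact: ball_compact_closed.
    + by move=> i; exact: eps_gt0.
    + by move=> i; exact: eta_gt0.
    + exact: (sub_cvg m).
    + by apply: (sub_cvg (fun i => eps i / m i ^+ 2)); exact: (shift_cvg _ _ eps_lim).
    + by apply: (sub_cvg (fun i => eta i / m i)); exact: (shift_cvg _ _ eta_lim).
    + by move=> i; have [_ [[_ hM _ _ _] _]] := hz (phi i); exact: (hM t).1.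
    + by move=> i; have [] := haq i.
  - apply: (@limit_field_in R H ip Hip (F t) t (x t) g zp v (fun i => (aq i).1)
      (fun i => 2 * M * m (phi i).+1)) => //.
    + exact: F_usc.
    + exact: F_nonempty.
    + exact: F_closed.
    + exact: F_convex.
  - by rewrite dxE.
  - apply: (@limit_velocity_le R H h Lh gam t (x t) w g zp v (fun i => (aq i).1)
      (fun i => err (phi i).+1) (fun i => 2 * M * m (phi i).+1)) => //.
    + exact: (sub_cvg err).
    + by move=> i; have [_ _ []] := haq i.
    + by move=> i; have [] := haq i.
exists (fun i => (phi i).+1), x; split.
- by split => // i j ij; rewrite ltnS; exact: phi_inc.
- apply: (@uniform_cvg_of_bound R H _ (fun i => xs (phi i).+1) x harmonic).
    exact: cvg_harmonic.
  by move=> i t /=; rewrite in_itv/=; exact: Xx.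
- by exists (2 * M); exact: lipschitz_on_segment.
- split => //; first exact: lipschitz_abs_continuous x_lip.
  apply: ae_imp main => t mt tI; have [dx [w [g [Nw Fg dE _]]]] := mt tI.
  by split => //; exists w => //; exists g => //; rewrite dE addrC.
- apply: ae_imp main => t mt tI; have [_ [w [g [_ _ -> gw]]]] := mt tI.
  exact: gw.
Qed.
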